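(* Let $X$ be a homogeneous tree of degree $q+1$ ($2\leq q<\infty$) with graph distance $\mathrm d$ and distinguished vertex $x_0$. For $z\in\mathbb C$ let $$\varphi_z(x)=f(z)q^{-z\,\mathrm d(x,x_0)}+f(1-z)q^{-(1-z)\mathrm d(x,x_0)},\qquad f(z)=(q+1)^{-1}\frac{q^{1-z}-q^{z-1}}{q^{-z}-q^{z-1}},$$ (extended by continuity in $z$ at the removable singularities $z=\tfrac12+i\tfrac{k\pi}{\ln q}$, $k\in\mathbb Z$), and let $\tilde\varphi_z(x,y)$ be the function on $X\times X$ with $\tilde\varphi_z(x,y)=\dot\varphi_z(\mathrm d(x,y))$ where $\varphi_z(x)=\dot\varphi_z(\mathrm d(x,x_0))$. Then $\tilde\varphi_z$ is a Schur multiplier if and only if $$z\in\{z:0<\Re(z)<1\}\cup\{i\tfrac{k\pi}{\ln q}:k\in\mathbb Z\}\cup\{1-i\tfrac{k\pi}{\ln q}:k\in\mathbb Z\}.$$ Moreover, for $0<\Re(z)<1$, $$\|\tilde\varphi_z\|_S=\frac{(1-\frac1q)^2|1-q^{-2z}||1-q^{2z-2}|}{(1-q^{-2\Re(z)})(1-q^{2\Re(z)-2})|1-q^{2i\Im(z)-1}|^2},$$ and $\|\tilde\varphi_z\|_S=1$ for $z\in\{i\tfrac{k\pi}{\ln q}\}\cup\{1-i\tfrac{k\pi}{\ln q}\}$.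
   Context: A homogeneous tree of degree $q+1$ is a connected cycle-free graph in which every vertex has exactly $q+1$ neighbours. A function $\psi:X\times X\to\mathbb C$ is a Schur multiplier if for every bounded operator $A=(a_{x,y})$ on $\ell^2(X)$ the matrix $(\psi(x,y)a_{x,y})$ again defines a bounded operator $M_\psi A$; $\|\psi\|_S:=\|M_\psi\|$. *)

(* Defs.v *)
From HB Require Import structures.
From mathcomp Require Import all_boot all_order all_algebra.
From mathcomp Require Import all_classical all_reals all_analysis.
From mathcomp Require Import complex.
Import Order.TTheory GRing.Theory Num.Theory numFieldNormedType.Exports numFieldTopology.Exports.

Set Implicit Arguments.
Unset Strict Implicit.
Unset Printing Implicit Defensive.

Local Open Scope ring_scope.
Local Open Scope complex_scope.

(* The (metric) topology of the complex numbers R[i], induced by the modulus. *)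
HB.instance Definition _ (R : rcfType) :=
  PseudoPointedMetric.copy R[i] (R[i] : numFieldType)^o.

Definition is_htree (X : eqType) (q : nat) (adj : rel X) : Prop :=
  [/\ symmetric adj,
      irreflexive adj,
      (forall x y : X, exists p : seq X, path adj x p /\ last x p = y),
      (forall (x : X) (p : seq X),
          path adj x p -> uniq (x :: p) -> (2 <= size p)%N -> ~~ adj (last x p) x)
    &
      (forall x : X, exists s : seq X,
          [/\ uniq s, size s = q.+1 & forall y, adj x y = (y \in s)])].

Definition gdist (X : eqType) (adj : rel X) (x y : X) : nat :=
  xget 0%N [set n : nat |
    (exists p : seq X, [/\ path adj x p, last x p = y & size p = n]) /\
    (forall p : seq X, path adj x p -> last x p = y -> (n <= size p)%N)].

Definition cpow (R : realType) (b : R) (w : R[i]) : R[i] :=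
  (powR b (complex.Re w))%:C * (cos (complex.Im w * ln b) +i* sin (complex.Im w * ln b)).

Definition cabs (R : rcfType) (z : R[i]) : R := Num.sqrt (complex.Re z ^+ 2 + complex.Im z ^+ 2).

Definition fq (R : realType) (q : nat) (z : R[i]) : R[i] :=
  ((q%:R + 1 : R)^-1)%:C * (cpow q%:R (1 - z) - cpow q%:R (z - 1))
    / (cpow q%:R (- z) - cpow q%:R (z - 1)).

Definition phi_expr (R : realType) (q : nat) (z : R[i]) (n : nat) : R[i] :=
  fq q z * cpow q%:R (- z * n%:R) + fq q (1 - z) * cpow q%:R (- (1 - z) * n%:R).

(* dot-phi_z(n), extended by continuity in z at the removable singularities
   (those z where q^(-z) = q^(z-1), i.e. z = 1/2 + i k pi / ln q). *)
Definition phidot (R : realType) (q : nat) (z : R[i]) (n : nat) : R[i] :=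
  if cpow q%:R (- z) - cpow q%:R (z - 1) != 0 then phi_expr q z n
  else lim ((fun w => phi_expr q w n) @ z^')%classic.

Definition phi (R : realType) (q : nat) (X : eqType) (adj : rel X) (x0 : X)
  (z : R[i]) (x : X) : R[i] := phidot q z (gdist adj x x0).

Definition phitilde (R : realType) (q : nat) (X : eqType) (adj : rel X)
  (z : R[i]) (x y : X) : R[i] := phidot q z (gdist adj x y).

(* A matrix a : X -> X -> C defines an operator on finitely supported        *)
(* vectors; its operator norm (in \bar R, +oo if unbounded) is the sup of   *)
(* |<A u, v>| = |sum_{x,y} conj(v x) a x y u y| over finitely supported      *)
(* u, v (supported on a finite duplicate-free list s) of l^2-norm <= 1.     *)
(* The matrix defines a bounded operator on l^2(X) iff this is finite, and  *)
(* then it is the norm of that operator.                                    *)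
Definition l2sq (R : rcfType) (X : eqType) (s : seq X) (u : X -> R[i]) : R :=
  \sum_(x <- s) cabs (u x) ^+ 2.

Definition bform (R : rcfType) (X : eqType) (s : seq X) (a : X -> X -> R[i])
  (u v : X -> R[i]) : R[i] :=
  \sum_(x <- s) \sum_(y <- s) (v x)^* * a x y * u y.

Definition mxnorm (R : realType) (X : eqType) (a : X -> X -> R[i]) : \bar R :=
  ereal_sup [set r : \bar R | exists (s : seq X) (u v : X -> R[i]),
     [/\ uniq s, l2sq s u <= 1, l2sq s v <= 1 & r = (cabs (bform s a u v))%:E]]%classic.

Definition schur_mul (R : rcfType) (X : Type) (psi a : X -> X -> R[i]) : X -> X -> R[i] :=
  fun x y => psi x y * a x y.

Definition is_schur (R : realType) (X : eqType) (psi : X -> X -> R[i]) : Prop :=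
  forall a : X -> X -> R[i], (mxnorm a < +oo)%E -> (mxnorm (schur_mul psi a) < +oo)%E.

Definition schur_norm (R : realType) (X : eqType) (psi : X -> X -> R[i]) : \bar R :=
  ereal_sup [set mxnorm (schur_mul psi a) |
               a in [set a : X -> X -> R[i] | (mxnorm a <= 1)%E]]%classic.

(* Main.v *)
(* Write a = q^-z, b = q^(z-1), so that ab = 1/q, and g_n = sum_k a^k b^(n-k).
   The identity g_(i+j) = g_i g_j - ab g_(i-1) g_(j-1) exhibits the spherical
   function as a rank one object: with kappa = q (1-a^2)(1-b^2)/(q+1),
     phi(n) - phi(n+2) = kappa g_n.
   Fix an end of the tree, and let c send a vertex to its neighbour towards the
   end.  If the rays of x and y first meet after m and n steps then
   d(x,y) = m+n, and telescoping gives
     phi(d(x,y)) = kappa sum_(i,j) g_i g_j K(c^i x, c^j y),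
   where K(v,w) = [v=w] - [c v = c w]/q is a projection.  This is a factorisation
   through vectors of squared length (1-1/q) sum |g_i|^2, whence the upper bound
   (1-1/q) |kappa| sum |g_i|^2.

   For the lower bound let U f = q^(-1/2) f o c, an isometry with adjoint V.
   The multiplier is tested on sum_(i,j) xi_i xi_j U^i (1 - U V) V^j against the
   almost invariant vectors L^(-1/2) sum_(k<L) U^k delta_o; this gives
   (1-1/q) |kappa| |sum xi_i g_i|^2 for every unit vector xi, hence equality in
   the strip, and unboundedness outside it, where |g_n| is bounded below and
   xi_i can be taken comparable to 1/(i+1).  At the exceptional points
   phi(n) = (+1 or -1)^n, which is a rank one unimodular kernel because the tree
   is bipartite. *)

Require Import Defs.
From HB Require Import structures.
From mathcomp Require Import all_boot all_order all_algebra.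
From mathcomp Require Import all_classical all_reals all_analysis.
From mathcomp Require Import complex.
From mathcomp Require Import zify ring lra.
Import Order.TTheory GRing.Theory Num.Theory numFieldNormedType.Exports numFieldTopology.Exports.

Set Implicit Arguments.
Unset Strict Implicit.
Unset Printing Implicit Defensive.

Local Open Scope complex_scope.
Local Open Scope ring_scope.

(** * Trees and ends *)

(** The end supplies what a root cannot: every vertex starts an infinite ray, so the telescoping sum
    meets no boundary at finite depth and its remainder is controlled by decay alone. The two bounds
    meet because the coefficients g_i g_j have rank one: up to the common factor the upper bound is
    the squared length of (g_i), and a test with xi proportional to the conjugates of the g_i is the
    equality case of Cauchy-Schwarz. The test matrix is fixed before the number of terms, so outside
    the strip one bounded matrix already has an unbounded image. The strip is |a|, |b| < 1;
    elsewhere one of the moduli is at least 1, and kappa vanishes only at the exceptional points,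
    where the kernel has to be treated directly. Estimates are phrased through s = a + b, in which
    phi(n) and g_n are polynomials, so that the double points a = b need no separate estimate.
    Operators on l^2(X) are never formed: a form sees finitely many vertices, and finite lists
    closed under siblings carry the inner products. *)

Section Tree.
Variables (X : eqType) (q : nat) (adj : rel X).
Hypothesis (tree : is_htree q adj).

Let sym : symmetric adj. Proof. by case: tree. Qed.
Let irr : irreflexive adj. Proof. by case: tree. Qed.

Lemma gdistP (x y : X) :
  (exists p : seq X, [/\ path adj x p, last x p = y & size p = gdist adj x y]) /\
  (forall p : seq X, path adj x p -> last x p = y -> (gdist adj x y <= size p)%N).
Proof.
rewrite /gdist; case: xgetP => [n _ []//|nex]; exfalso.
have [_ _ conn _ _] := tree; have [p [pp lp]] := conn x y.
have ex : exists n, `[< exists p : seq X, [/\ path adj x p, last x p = y & size p = n] >].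
  by exists (size p); apply/asboolP; exists p.
case: (ex_minnP ex) => n /asboolP pn nmin.
apply: (nex n); split=> // r pr lr; apply: nmin; apply/asboolP; by exists r.
Qed.

Lemma gdist_path (x : X) (p : seq X) : path adj x p -> (gdist adj x (last x p) <= size p)%N.
Proof. by move=> pp; apply: (gdistP x (last x p)).2. Qed.

Lemma gdistxx (x : X) : gdist adj x x = 0.
Proof. by have := @gdist_path x [::] isT; rewrite leqn0 => /eqP. Qed.

Lemma gdist0_eq (x y : X) : gdist adj x y = 0 -> x = y.
Proof. by have [[p [_ lp sp]] _] := gdistP x y => d0; move: sp lp; rewrite d0; case: p. Qed.

Lemma gdist_adj (x y r : X) : adj x y -> (gdist adj x r <= (gdist adj y r).+1)%N.
Proof.
have [[p [pp lp sp]] _] := gdistP y r; move=> axy.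
by rewrite -sp -lp; apply: (@gdist_path x (y :: p)); rewrite /= axy.
Qed.

Lemma rev_walk (x : X) (p : seq X) : path adj x p ->
  path adj (last x p) (rev (belast x p)) /\ last (last x p) (rev (belast x p)) = x.
Proof.
move=> pp; split.
  by rewrite rev_path; apply: sub_path pp => u v; rewrite sym.
by case: p pp => //= y p _; rewrite rev_cons last_rcons.
Qed.

(** If the geodesic passed through [y], its tail from [y] would bring [y] strictly closer to [r]
    than [x]. *)
Lemma geodesic_avoid (x y r : X) (p : seq X) :
  path adj x p -> last x p = r -> size p = gdist adj x r ->
  x != y -> (gdist adj x r <= gdist adj y r)%N -> y \notin x :: p.
Proof.
move=> pp lp sp xy le; rewrite inE negb_or eq_sym xy /=; apply/negP => yp.
case/splitPr: yp pp lp sp le => p1 p2; rewrite cat_path last_cat /= => /and3P[_ _ p2p] lp sp.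
rewrite -sp size_cat /= -lp leqNgt => /negP; apply.
by apply: leq_ltn_trans (gdist_path p2p) _; rewrite addnS ltnS leq_addl.
Qed.

(* Two distinct neighbours no farther from r would close a cycle through y. *)
Lemma closer_neighbour_uniq (y y1 y2 r : X) : adj y y1 -> adj y y2 ->
  (gdist adj y1 r <= gdist adj y r)%N -> (gdist adj y2 r <= gdist adj y r)%N ->
  y1 = y2.
Proof.
move=> a1 a2 le1 le2; apply/eqP; apply/negPn/negP => neq.
have n1 : y1 != y by apply/eqP => e; move: a1; rewrite e irr.
have n2 : y2 != y by apply/eqP => e; move: a2; rewrite e irr.
have [[p1 [pp1 lp1 sp1]] _] := gdistP y1 r.
have [[p2 [pp2 lp2 sp2]] _] := gdistP y2 r.
have v1 := geodesic_avoid pp1 lp1 sp1 n1 le1.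
have v2 := geodesic_avoid pp2 lp2 sp2 n2 le2.
have [rp2 rl2] := rev_walk pp2.
pose w := p1 ++ rev (belast y2 p2).
have pw : path adj y1 w by rewrite cat_path pp1 lp1 -lp2.
have lw : last y1 w = y2 by rewrite last_cat lp1 -lp2.
have vw : y \notin y1 :: w.
  rewrite -cat_cons mem_cat negb_or v1 /= mem_rev; apply: contra v2 => h.
  exact: mem_belast h.
move: lw vw; case: (shortenP pw) => p' pp' up' sub lw vw.
have [_ _ _ cyc _] := tree.
have := cyc y (y1 :: p').
rewrite [path _ _ _]/= a1 pp' => /(_ isT).
rewrite cons_uniq up' andbT.
have -> : y \notin y1 :: p'.
  apply: contra vw; rewrite !inE => /orP[->//|/sub ->]; by rewrite orbT.
move=> /(_ isT); rewrite /= lw sym a2 /=.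
by case: p' lw {pp' up' sub} => [/= e|? ? _ /(_ isT)//]; rewrite e eqxx in neq.
Qed.

(** A first failure to move away from [w 0] would give [w j.+1] two neighbours no farther from
    [w 0], namely [w j] and [w j.+2]; they would coincide and the walk would backtrack. *)
Lemma gdist_walk (w : nat -> X) (k : nat) :
  (forall i, (i < k)%N -> adj (w i) (w i.+1)) ->
  (forall i, (i.+1 < k)%N -> w i.+2 != w i) -> gdist adj (w k) (w 0) = k.
Proof.
move=> aw nw.
(* Two consecutive distances are carried together, since the step to [j.+2] compares with [w j]. *)
suff: forall j, (j <= k)%N -> gdist adj (w j) (w 0) = j /\
   ((j < k)%N -> gdist adj (w j.+1) (w 0) = j.+1).
  by move=> /(_ k (leqnn k))[].
elim=> [_|j IH jk].
  split; first exact: gdistxx.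
  move=> k0; apply/eqP; rewrite eqn_leq; apply/andP; split.
    by have := @gdist_adj (w 1) (w 0) (w 0); rewrite sym aw // gdistxx => ->.
  rewrite lt0n; apply/eqP => /gdist0_eq e.
  by have := aw 0 k0; rewrite e irr.
have [gj gj1] := IH (ltnW jk); split; first exact: gj1.
move=> j2; have e1 := gj1 jk.
apply/eqP; rewrite eqn_leq; apply/andP; split.
  by rewrite -[in X in (_ <= X)%N]e1; apply: gdist_adj; rewrite sym aw.
rewrite ltnNge; apply/negP => le.
have := nw _ j2; rewrite (@closer_neighbour_uniq (w j.+1) (w j.+2) (w j) (w 0)) ?eqxx //.
- exact: aw.
- by rewrite sym aw.
- by rewrite e1.
- by rewrite e1 gj leqnSn.
Qed.

Lemma exists_closer (x r : X) : x != r ->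
  exists y, adj x y && ((gdist adj y r).+1 == gdist adj x r).
Proof.
move=> xr; have [[[|y p] [pp lp sp]] _] := gdistP x r.
  by rewrite /= in lp; rewrite lp eqxx in xr.
move: pp => /= /andP[axy pp]; exists y; rewrite axy /= eqn_leq.
apply/andP; split; last exact: gdist_adj.
by rewrite -sp /= ltnS -[r]lp /= gdist_path.
Qed.

(** This is bipartiteness. With equal distances, [y] and the neighbour of [x] on a geodesic to [r]
    would both be no farther from [r] than [x], hence equal, although their distances differ. *)
Lemma gdist_adj_neq (x y r : X) : adj x y -> gdist adj x r <> gdist adj y r.
Proof.
move=> axy e.
have [xr|/exists_closer[z /andP[axz /eqP ez]]] := eqVneq x r.
  move: e; rewrite xr gdistxx => /esym /gdist0_eq yr.
  by move: axy; rewrite xr yr irr.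
have yz : y = z by apply: (@closer_neighbour_uniq x y z r); rewrite ?e // -?e -?ez.
by move: ez; rewrite -yz -e; lia.
Qed.

Lemma neighbours (x : X) : exists s : seq X,
  [/\ uniq s, size s = q.+1 & forall y, adj x y = (y \in s)].
Proof. by have [_ _ _ _ h] := tree; exact: h. Qed.

(** * Edges oriented towards a fixed end: [cxor] orients each edge, [cmerge] makes any two rays
    meet *)

Section End.
Variable c : X -> X.
Hypothesis (cadj : forall x, adj x (c x)).
Hypothesis (cxor : forall x y, adj x y -> (c x == y) (+) (c y == x)).
Hypothesis (cmerge : forall x y, exists m n, iter m c x = iter n c y).

Lemma end_children : exists ch : X -> seq X,
  forall y, [/\ uniq (ch y), size (ch y) = q & forall x, (x \in ch y) = (c x == y)].
Proof.
suff [ch hch] : {ch : X -> seq X & forall y,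
    [/\ uniq (ch y), size (ch y) = q & forall x, (x \in ch y) = (c x == y)]} by exists ch.
apply: (@choice _ _ (fun y s => [/\ uniq s, size s = q & forall x, (x \in s) = (c x == y)])) => y.
have [s [us ss hs]] := neighbours y.
(* Removing the parent from the q+1 neighbours leaves the q children. *)
exists (rem (c y) s); split; first exact: rem_uniq.
  by rewrite size_rem ?ss // -hs.
move=> x; rewrite (rem_filter _ us) mem_filter /= -hs eq_sym.
apply/andP/eqP => [[nx ayx]|<-].
  by have := cxor ayx; rewrite (negbTE nx) => /eqP.
have axc := cadj x; split; last by rewrite sym.
by have := cxor axc; rewrite eqxx; case: eqP.
Qed.

Lemma end_cc (x : X) : c (c x) != x.
Proof. by have := cxor (cadj x); rewrite eqxx. Qed.

(** Rays that have met stay together, so minimality is tested one step back only. The guards exempt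
    the case of one vertex being an ancestor of the other, where [.-1] would not step back. *)
Definition first_merge (x y : X) (m n : nat) : Prop :=
  iter m c x = iter n c y /\
  ((0 < m)%N -> (0 < n)%N -> iter m.-1 c x <> iter n.-1 c y).

Lemma gdist_merge (x y : X) (m n : nat) :
  first_merge x y m n -> gdist adj x y = (m + n)%N.
Proof.
case=> e ne.
(* Up the ray of [y] for n steps, then down the ray of [x]; both formulas agree at index n. *)
pose w i := if (i <= n)%N then iter i c y else iter (m + n - i) c x.
have wn i : (n <= i)%N -> (i <= m + n)%N -> w i = iter (m + n - i) c x.
  move=> ni im; rewrite /w; case: ifP => // i_n.
  have -> : i = n by lia.
  by rewrite addnK e.
have -> : y = w 0 by [].
have {1}-> : x = w (m + n)%N.
  by rewrite wn ?subnn ?leq_addl.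
apply: gdist_walk => i ik.
  have [i_n|n_i] := ltnP i n; first by rewrite /w i_n (ltnW i_n) iterS.
  rewrite !wn; try lia.
  by rewrite sym -(subnSK ik) iterS.
have [i_n|n_i] := ltnP i.+1 n; first by rewrite /w i_n (ltnW (ltnW i_n)) !iterS end_cc.
have [n_i2|i_n2] := leqP n i.
  rewrite !wn; try lia.
  have -> : (m + n - i)%N = (m + n - i.+2).+2 by lia.
  by rewrite !iterS eq_sym end_cc.
(* At the turning point the two neighbours on the walk are the last vertices before the meeting,
   which [first_merge] keeps distinct. *)
have in1 : n = i.+1 by lia.
rewrite wn; try lia.
rewrite /w in1 leqnSn; apply/eqP.
have -> : (m + i.+1 - i.+2)%N = m.-1 by lia.
have -> : i = n.-1 by rewrite in1.
by apply: ne; lia.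
Qed.

Lemma iter_end_inj (x : X) : injective (fun i => iter i c x).
Proof.
move=> i j e; wlog ij : i j e / (i <= j)%N.
  by move=> H; have [/H->//|/ltnW/H->//] := leqP i j.
have /gdist_merge : first_merge (iter i c x) (iter j c x) (j - i) 0.
  by split=> //=; rewrite -iterD subnK.
by rewrite /= in e; rewrite e gdistxx addn0; lia.
Qed.

Lemma exists_first_merge (x y : X) : exists m n, first_merge x y m n.
Proof.
have [m [n e]] := cmerge x y.
elim: m n e => [|m IH] n e; first by exists 0%N, n.
case: n e => [|n] e; first by exists m.+1, 0%N.
have [e'|ne] := pselect (iter m c x = iter n c y); first exact: IH e'.
by exists m.+1, n.+1; split.
Qed.

(** Injectivity along the ray of [y] forces [i + n = j + m]; a pair with [i < m] would then make the
    rays meet before their first meeting. *)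
Lemma first_mergeP (x y : X) (m n i j : nat) : first_merge x y m n ->
  (iter i c x = iter j c y) <-> exists k, i = (m + k)%N /\ j = (n + k)%N.
Proof.
case=> e ne; split=> [e'|[k [-> ->]]]; last first.
  by rewrite ![(_ + k)%N]addnC !iterD e.
have eq : (i + n = j + m)%N.
  apply: (@iter_end_inj y) => /=.
  by rewrite iterD -e -iterD addnC iterD e' -iterD addnC.
have [im|mi] := ltnP i m.
  exfalso; apply: ne; [lia|lia|].
  have -> : m.-1 = (m.-1 - i + i)%N by lia.
  have -> : n.-1 = (m.-1 - i + j)%N by lia.
  by rewrite !iterD e'.
by exists (i - m)%N; lia.
Qed.

End End.

Hypothesis (q2 : (2 <= q)%N).

Lemma exists_farther (x r : X) : exists y, adj x y && (gdist adj y r == (gdist adj x r).+1).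
Proof.
have [s [us ss hs]] := neighbours x.
case: (pselect (exists2 y, y \in s & (gdist adj x r < gdist adj y r)%N)).
  move=> [y ys lt]; exists y; rewrite hs ys /= eqn_leq lt andbT.
  by apply: gdist_adj; rewrite sym hs.
move=> no.
have cl y : y \in s -> (gdist adj y r <= gdist adj x r)%N.
  by move=> ys; rewrite leqNgt; apply/negP => lt; apply: no; exists y.
case: s us ss hs cl {no} => [|y1 [|y2 s]] //= us [ss] hs cl; first by move: q2; lia.
have e : y1 = y2.
  apply: (@closer_neighbour_uniq x _ _ r); rewrite ?hs ?inE ?eqxx ?orbT //.
    by apply: cl; rewrite inE eqxx.
  by apply: cl; rewrite !inE eqxx orbT.
by move: us; rewrite e inE eqxx.
Qed.

(* The end is chosen as the limit of a geodesic ray from [x0]; the parent of a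
   vertex off the ray is its neighbour closer to [x0]. *)
Lemma exists_end (x0 : X) : exists c : X -> X,
  [/\ forall x, adj x (c x),
      forall x y, adj x y -> (c x == y) (+) (c y == x) &
      forall x y, exists m n, iter m c x = iter n c y].
Proof.
pose l x := gdist adj x x0.
have [child hchild] : {f : X -> X & forall x, adj x (f x) && (l (f x) == (l x).+1)}.
  by apply: (@choice _ _ (fun x y => adj x y && (l y == (l x).+1))) => x; exact: exists_farther.
have [par hpar] : {f : X -> X & forall x, x != x0 -> adj x (f x) && ((l (f x)).+1 == l x)}.
  apply: (@choice _ _ (fun x y => x != x0 -> adj x y && ((l y).+1 == l x))) => x.
  have [->|/exists_closer[y hy]] := eqVneq x x0; first by exists x0.
  by exists y.
pose r k := iter k child x0.
have lr k : l (r k) = k.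
  elim: k => [|k IH]; first exact: gdistxx.
  by have /andP[_ /eqP] := hchild (r k); rewrite -/(r k.+1) IH.
(* The ray has exactly one vertex at each distance from [x0], so membership is decided at index
   [l x]. *)
pose on x := r (l x) == x.
pose c x := if on x then child x else par x.
have on0 : on x0 by rewrite /on /l gdistxx.
have off_neq x : ~~ on x -> x != x0 by apply: contraNneq => ->.
have onr k : on (r k) by rewrite /on lr.
have cadj x : adj x (c x).
  rewrite /c; case: ifPn => [_|/off_neq/hpar/andP[]//].
  by have /andP[] := hchild x.
have on_child x : on x -> on (child x).
  by move=> /eqP <-; rewrite -[child _]/(r (l x).+1); exact: onr.
have uniq_par x y z : adj x y -> adj x z -> (l y).+1 = l x -> (l z).+1 = l x -> y = z.
  by rewrite /l => ay az ey ez; apply: (closer_neighbour_uniq (r := x0) ay az); lia.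
have key x y : adj x y -> (l y).+1 = l x -> (c x == y) (+) (c y == x).
  move=> axy lyx.
  have xn0 : x != x0 by apply/eqP => e; move: lyx; rewrite e /l gdistxx.
  have [ox|ox] := boolP (on x).
    have xe : x = child (r (l y)) by move/eqP: ox; rewrite -lyx.
    have ye : y = r (l y).
      apply: (uniq_par x); rewrite ?lr //.
      by rewrite [x in adj x]xe sym; have /andP[] := hchild (r (l y)).
    have oy : on y by rewrite ye onr.
    have -> : c y == x by rewrite /c oy ye -xe.
    rewrite /c ox addbT; apply/eqP => e.
    by have /andP[_ /eqP] := hchild x; rewrite e -lyx; lia.
  have /andP[ap /eqP lp] := hpar _ xn0.
  have -> : c x == y.
    by rewrite /c (negbTE ox); apply/eqP; apply: (uniq_par x).
  rewrite addTb; apply/eqP; rewrite /c; case: ifPn => [oy e|oy e].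
    by move: ox; rewrite -e on_child.
  have /andP[_ /eqP] := hpar _ (off_neq _ oy); rewrite e -lyx; lia.
exists c; split=> //.
  move=> x y axy.
  have h1 : (l x <= (l y).+1)%N by exact: gdist_adj.
  have h2 : (l y <= (l x).+1)%N by apply: gdist_adj; rewrite sym.
  have h3 : l x <> l y by exact: gdist_adj_neq.
  have [e|e] : (l y).+1 = l x \/ (l x).+1 = l y by lia.
    exact: key.
  by rewrite addbC; apply: key => //; rewrite sym.
(* Off the ray parents lie closer to [x0], so iterating [c] reaches the ray, along which [c] is a
   shift. *)
have toray x : exists m k, iter m c x = r k.
  have [n] := ubnP (l x); elim: n x => // n IH x lx.
  have [ox|ox] := boolP (on x); first by exists 0, (l x); apply/esym/eqP.
  have /andP[_ /eqP lp] := hpar _ (off_neq _ ox).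
  have [|m [k e]] := IH (c x); first by rewrite /c (negbTE ox); lia.
  by exists m.+1, k; rewrite iterSr.
have cr k i : iter i c (r k) = r (i + k)%N.
  by elim: i => //= i ->; rewrite /c onr.
move=> x y; have [m [k e]] := toray x; have [n [j e']] := toray y.
by exists (j + m)%N, (k + n)%N; rewrite !iterD e e' !cr addnC.
Qed.

End Tree.

(** * Matrix norms and Schur factorisations *)

Section Modulus.
Variable R : rcfType.
Implicit Types z w : R[i].

Lemma normc_cabs z : `|z| = (cabs z)%:C.
Proof. exact: normc_def. Qed.

Lemma cabs_ge0 z : 0 <= cabs z.
Proof. exact: sqrtr_ge0. Qed.

Lemma cabsM z w : cabs (z * w) = cabs z * cabs w.
Proof. by apply: complexI; rewrite rmorphM /= -!normc_cabs normrM. Qed.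

Lemma cabsV z : cabs z^-1 = (cabs z)^-1.
Proof. by apply: complexI; rewrite fmorphV /= -!normc_cabs normfV. Qed.

Lemma cabs_real (x : R) : 0 <= x -> cabs x%:C = x.
Proof. by move=> x0; apply: complexI; rewrite -normc_cabs ger0_norm ?ler0c. Qed.

Lemma cabsX z n : cabs (z ^+ n) = cabs z ^+ n.
Proof. by apply: complexI; rewrite rmorphXn /= -!normc_cabs normrX. Qed.

Lemma cabs0 : cabs (0 : R[i]) = 0.
Proof. exact: (@cabs_real 0). Qed.

Lemma cabs1 : cabs (1 : R[i]) = 1.
Proof. exact: (@cabs_real 1). Qed.

Lemma cabsN z : cabs (- z) = cabs z.
Proof. by apply: complexI; rewrite -!normc_cabs normrN. Qed.

Lemma cabs_eq0 z : (cabs z == 0) = (z == 0).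
Proof. by rewrite -[RHS]normr_eq0 normc_cabs -(inj_eq (@complexI R)). Qed.

Lemma cabs_conj z : cabs z^* = cabs z.
Proof. by apply: complexI; rewrite -!normc_cabs norm_conjC. Qed.

Lemma cabsD z w : cabs (z + w) <= cabs z + cabs w.
Proof. by rewrite -lecR rmorphD /= -!normc_cabs ler_normD. Qed.

Lemma cabsB z w : cabs (z - w) <= cabs z + cabs w.
Proof. by rewrite -[cabs w]cabsN cabsD. Qed.

Lemma cabs_sum (I : Type) (r : seq I) (P : pred I) (F : I -> R[i]) :
  cabs (\sum_(i <- r | P i) F i) <= \sum_(i <- r | P i) cabs (F i).
Proof.
apply: (big_ind2 (fun z x => cabs z <= x)) => //; first by rewrite cabs0.
by move=> z x w y zx wy; apply: le_trans (cabsD _ _) (lerD zx wy).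
Qed.

Lemma conj_real (x : R) : (x%:C)^* = x%:C.
Proof. exact: conjc_real. Qed.

Lemma conj_mul z w : (z * w)^* = z^* * w^*.
Proof. exact: rmorphM. Qed.

Lemma sqr_cabs z : (cabs z ^+ 2)%:C = z * z^*.
Proof.
by rewrite rmorphXn /= -normc_cabs normCK.
Qed.

End Modulus.

Section Forms.
Variables (R : realType) (X : eqType).
Implicit Types (a psi : X -> X -> R[i]) (u v : X -> R[i]) (s : seq X).

Lemma l2sq_ge0 s u : 0 <= l2sq s u.
Proof. by apply: sumr_ge0 => x _; apply: exprn_ge0; apply: cabs_ge0. Qed.

Lemma l2sq0 s u x : l2sq s u = 0 -> x \in s -> u x = 0.
Proof.
move=> /eqP; rewrite psumr_eq0 => [/allP h xs|i _]; last by apply: exprn_ge0; apply: cabs_ge0.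
by have := h x xs; rewrite /= expf_eq0 /= cabs_eq0 => /eqP.
Qed.

Lemma l2sqZ s u (k : R[i]) : l2sq s (fun x => k * u x) = cabs k ^+ 2 * l2sq s u.
Proof. by rewrite /l2sq mulr_sumr; apply: eq_bigr => x _; rewrite cabsM exprMn. Qed.

Lemma bformZ s a u v (k l : R) :
  bform s a (fun x => k%:C * u x) (fun x => l%:C * v x) = (k * l)%:C * bform s a u v.
Proof.
rewrite /bform mulr_sumr; apply: eq_bigr => x _; rewrite mulr_sumr; apply: eq_bigr => y _.
by rewrite conj_mul conj_real rmorphM /=; ring.
Qed.

Lemma mxnorm_ge0 a : (0 <= mxnorm a)%E.
Proof.
apply: ereal_sup_ubound; exists [::], (fun=> 0), (fun=> 0).
by rewrite /l2sq /bform !big_nil cabs0 !ler01.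
Qed.

Lemma le_mxnorm s a u v : uniq s -> l2sq s u <= 1 -> l2sq s v <= 1 ->
  ((cabs (bform s a u v))%:E <= mxnorm a)%E.
Proof. by move=> us lu lv; apply: ereal_sup_ubound; exists s, u, v. Qed.

Lemma mxnorm_le a (M : R) :
  (forall s u v, uniq s -> l2sq s u <= 1 -> l2sq s v <= 1 -> cabs (bform s a u v) <= M) ->
  (mxnorm a <= M%:E)%E.
Proof. by move=> h; apply: ge_ereal_sup => _ [s [u [v [us lu lv ->]]]]; rewrite lee_fin h. Qed.

(** The mean of the squared norms replaces the product of the norms: it is additive, so such bounds
    can be summed over the terms of a factorisation. *)
Lemma bform_bound s a u v (M : R) : uniq s -> (mxnorm a <= M%:E)%E ->
  cabs (bform s a u v) <= M * ((l2sq s u + l2sq s v) / 2).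
Proof.
move=> us aM.
have M0 : 0 <= M by rewrite -lee_fin; apply: le_trans aM; apply: mxnorm_ge0.
have rhs0 : 0 <= M * ((l2sq s u + l2sq s v) / 2).
  by rewrite mulr_ge0 // divr_ge0 // addr_ge0 // l2sq_ge0.
(* A vector of norm zero cannot be normalised, but then the form vanishes. *)
have bz : (l2sq s u == 0) || (l2sq s v == 0) -> bform s a u v = 0.
  move=> h; rewrite /bform big_seq big1 // => x xs; rewrite big_seq big1 // => y ys.
  case/orP: h => /eqP h; first by rewrite (l2sq0 h ys) mulr0.
  by rewrite (l2sq0 h xs) conjC0 !mul0r.
have [/eqP u0|u0] := boolP (l2sq s u == 0); first by rewrite bz ?cabs0 // u0 eqxx.
have [/eqP v0|v0] := boolP (l2sq s v == 0); first by rewrite bz ?cabs0 // v0 eqxx orbT.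
pose k := Num.sqrt (l2sq s u); pose l := Num.sqrt (l2sq s v).
have k0 : 0 < k by rewrite sqrtr_gt0 lt_def u0 l2sq_ge0.
have l0 : 0 < l by rewrite sqrtr_gt0 lt_def v0 l2sq_ge0.
have kE : k ^+ 2 = l2sq s u by rewrite sqr_sqrtr ?l2sq_ge0.
have lE : l ^+ 2 = l2sq s v by rewrite sqr_sqrtr ?l2sq_ge0.
have n1 (w : X -> R[i]) (m : R) : 0 < m -> m ^+ 2 = l2sq s w ->
    l2sq s (fun x => (m^-1)%:C * w x) <= 1.
  move=> m0 mE; rewrite l2sqZ cabs_real ?invr_ge0 ?(ltW m0) // -mE -exprMn.
  by rewrite mulVf ?gt_eqF // expr1n.
have := le_trans (le_mxnorm a us (n1 u k k0 kE) (n1 v l l0 lE)) aM.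
rewrite lee_fin bformZ cabsM cabs_real; last by rewrite mulr_ge0 ?invr_ge0 ?ltW.
rewrite -invfM mulrC ler_pdivrMr ?mulr_gt0 // => h; apply: le_trans h _.
rewrite ler_wpM2l // -kE -lE; have := sqr_ge0 (k - l); rewrite ler_pdivlMr // sqrrB; lra.
Qed.

(** The factorisation writes the Schur product as a sum over [t] of D_t A D_t with D_t diagonal.
    Neither factor is conjugated, so moving the left one onto [v] introduces a conjugate, which
    leaves norms unchanged. *)
Lemma schur_factor_bound s (T : Type) (W : seq T) (P : X -> T -> R[i]) psi a u v (M K : R) :
  uniq s -> 0 <= K -> (mxnorm a <= M%:E)%E ->
  {in s &, forall x y, psi x y = \sum_(t <- W) P x t * P y t} ->
  {in s, forall x, \sum_(t <- W) cabs (P x t) ^+ 2 <= K} ->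
  cabs (bform s (schur_mul psi a) u v) <= K * M * ((l2sq s u + l2sq s v) / 2).
Proof.
move=> us K0 aM psiE PK.
have M0 : 0 <= M by rewrite -lee_fin; apply: le_trans aM; apply: mxnorm_ge0.
have -> : bform s (schur_mul psi a) u v =
    \sum_(t <- W) bform s a (fun y => P y t * u y) (fun x => (P x t)^* * v x).
  rewrite /bform [RHS]exchange_big; apply: eq_big_seq => x xs.
  rewrite [RHS]exchange_big; apply: eq_big_seq => y ys.
  rewrite /schur_mul psiE // mulr_suml mulr_sumr mulr_suml; apply: eq_bigr => t _.
  by rewrite conj_mul conjCK; ring.
apply: le_trans (cabs_sum _ _ _) _.
have sumP (w : X -> R[i]) (Q : X -> T -> R[i]) :
    (forall x t, cabs (Q x t) = cabs (P x t)) ->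
    \sum_(t <- W) l2sq s (fun x => Q x t * w x) <= K * l2sq s w.
  move=> QP; rewrite exchange_big /= [X in _ <= X]mulr_sumr big_seq [X in _ <= X]big_seq.
  apply: ler_sum => x xs; under eq_bigr do rewrite cabsM exprMn QP.
  by rewrite -mulr_suml ler_wpM2r ?exprn_ge0 ?cabs_ge0 ?PK.
apply: le_trans (_ : \sum_(t <- W) (M / 2) * (l2sq s (fun y => P y t * u y) +
    l2sq s (fun x => (P x t)^* * v x)) <= _).
  by apply: ler_sum => t _; apply: le_trans (bform_bound _ _ us aM) _; lra.
rewrite -mulr_sumr big_split /=.
apply: le_trans (_ : M / 2 * (K * l2sq s u + K * l2sq s v) <= _); last by lra.
rewrite ler_wpM2l ?divr_ge0 // lerD //; apply: sumP => // x t; exact: cabs_conj.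
Qed.

End Forms.

(** * Recurrences for spherical functions *)

Section Recurrences.
Variables (K : fieldType) (q : nat).
Hypotheses (q0 : q%:R != 0 :> K) (q1 : q%:R + 1 != 0 :> K).
Local Notation Q := (q%:R : K).
Variable s : K.

(* With a = q^-z, b = q^(z-1) and s = a + b (so that ab = 1/q), [cheb n] is
   (a^n - b^n)/(a - b) and [sph n] is the value of phi_z at distance n. *)
Fixpoint cheb (n : nat) : K :=
  if n is m.+1 then if m is k.+1 then s * cheb m - Q^-1 * cheb k else 1 else 0.

Fixpoint sph (n : nat) : K :=
  if n is m.+1 then
    if m is k.+1 then s * sph m - Q^-1 * sph k else Q / (Q + 1) * s
  else 1.

(** A function of s alone, because ab = 1/q gives (1-a^2)(1-b^2) = (1+ab)^2 - (a+b)^2. *)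
Definition kappa : K := Q / (Q + 1) * ((1 + Q^-1) ^+ 2 - s ^+ 2).

Lemma chebSS n : cheb n.+2 = s * cheb n.+1 - Q^-1 * cheb n.
Proof. by []. Qed.

Lemma sphSS n : sph n.+2 = s * sph n.+1 - Q^-1 * sph n.
Proof. by []. Qed.

Lemma nat_ind2 (P : nat -> Prop) :
  P 0%N -> P 1%N -> (forall n, P n -> P n.+1 -> P n.+2) -> forall n, P n.
Proof.
move=> P0 P1 PS n; suff: P n /\ P n.+1 by case.
by elim: n => // n [Pn Pn1]; split=> //; apply: PS.
Qed.

(** Both sides obey the same second order recurrence, so n = 0 and n = 1 decide; the case n = 0 is
    what fixes [kappa]. *)
Lemma sph_diff n : sph n - sph n.+2 = kappa * cheb n.+1.
Proof.
elim/nat_ind2: n => [||n IH0 IH1].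
- by rewrite /kappa /=; field; rewrite q0 q1.
- by rewrite /kappa /=; field; rewrite q0 q1.
have -> : sph n.+2 - sph n.+4 = s * (sph n.+1 - sph n.+3) - Q^-1 * (sph n - sph n.+2).
  by rewrite [sph n.+4]sphSS {1}[sph n.+2]sphSS; ring.
by rewrite IH0 IH1 [cheb n.+3]chebSS; ring.
Qed.

(** Here g_n is [cheb n.+1], and [cheb 0 = 0] stands for g_(-1); this convention removes the
    boundary terms when sums are shifted by one. *)
Lemma chebD i j : cheb (i + j).+1 = cheb i.+1 * cheb j.+1 - Q^-1 * (cheb i * cheb j).
Proof.
elim/nat_ind2: i => [||i IH0 IH1].
- by rewrite add0n -[cheb 1]/1 -[cheb 0]/0; ring.
- by rewrite add1n !chebSS -[cheb 1]/1 -[cheb 0]/0; ring.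
rewrite !addSn chebSS -addSn IH1 IH0 [cheb i.+3]chebSS [cheb i.+2]chebSS; ring.
Qed.

(** Drives the induction over generations in [desc_sum_diag]: up to a power of q, the right side is
    what summation over children produces. *)
Lemma sph_chebM i j :
  sph (i + j).+2 + kappa * (cheb i.+1 * cheb j.+1)
    = sph (i + j) + kappa * Q^-1 * (cheb i * cheb j).
Proof.
apply/eqP; rewrite -subr_eq0; apply/eqP.
have := sph_diff (i + j); rewrite chebD => h.
have -> : sph (i + j).+2 = sph (i + j) - (sph (i + j) - sph (i + j).+2) by ring.
rewrite h; ring.
Qed.

End Recurrences.

Section ClosedForms.
Variables (K : fieldType) (q : nat).
Hypotheses (q0 : q%:R != 0 :> K) (q1 : q%:R + 1 != 0 :> K).
Local Notation Q := (q%:R : K).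
Variables (a b : K).
Hypothesis ab : a * b = Q^-1.

Lemma cheb_closed n : (a - b) * cheb q (a + b) n = a ^+ n - b ^+ n.
Proof.
elim/nat_ind2: n => [||n IH0 IH1]; first by rewrite /= expr0 subrr mulr0.
  by rewrite /= !expr1 mulr1.
rewrite chebSS mulrBr mulrCA IH1 mulrCA IH0 -ab !exprS; ring.
Qed.

Lemma sph_closed n : (Q + 1) * (a - b) * sph q (a + b) n
  = (Q * a - b) * a ^+ n - (Q * b - a) * b ^+ n.
Proof.
elim/nat_ind2: n => [||n IH0 IH1]; first by rewrite /=; ring.
  by rewrite /=; field.
rewrite sphSS mulrBr mulrCA IH1 mulrCA IH0 -ab !exprS; ring.
Qed.

Lemma kappa_closed : kappa q (a + b) = Q / (Q + 1) * ((1 - a ^+ 2) * (1 - b ^+ 2)).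
Proof. by rewrite /kappa -ab; ring. Qed.

(** Unlike [cheb_closed], this form still determines the value when a = b, as the decay estimate
    requires. *)
Lemma cheb_sum n : cheb q (a + b) n = \sum_(i < n) a ^+ i * b ^+ (n.-1 - i).
Proof.
elim/nat_ind2: n => [||n IH0 IH1]; first by rewrite big_ord0.
  by rewrite big_ord1 /= expr0 mulr1.
rewrite chebSS -ab.
have e m : \sum_(i < m.+1) a ^+ i * b ^+ (m - i) =
    a ^+ m + b * \sum_(i < m) a ^+ i * b ^+ (m.-1 - i).
  rewrite big_ord_recr /= subnn mulr1 addrC mulr_sumr; congr (_ + _).
  apply: eq_bigr => i _; rewrite mulrCA -exprS; congr (_ * _ ^+ _).
  by have := ltn_ord i; lia.
by rewrite IH1 IH0 /= (e n.+1) (e n) exprS; ring.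
Qed.

End ClosedForms.

Arguments cheb : simpl never.
Arguments sph : simpl never.

(** * Upper bound *)

Section Kernel.
Variables (R : realType) (X : eqType) (q : nat) (c : X -> X) (ch : X -> seq X).
Hypothesis (q2 : (2 <= q)%N).
Hypothesis (chP : forall y, [/\ uniq (ch y), size (ch y) = q & forall x, (x \in ch y) = (c x == y)]).
Local Notation C := R[i].
Local Notation Q := (q%:R : C).

Let q0 : Q != 0. Proof. by rewrite pnatr_eq0; lia. Qed.
Let q1 : Q + 1 != 0. Proof. by rewrite natr1 pnatr_eq0. Qed.

(* The projection 1 - U V, where U is the isometry f |-> q^(-1/2) (f o c) of
   l^2(X) and V its adjoint. *)
Definition sib_kernel (x y : X) : C := (x == y)%:R - Q^-1 * (c x == c y)%:R.

Lemma sib_kernelC x y : sib_kernel x y = sib_kernel y x.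
Proof. by rewrite /sib_kernel eq_sym [c x == _]eq_sym. Qed.

Lemma conj_sib_kernel x y : (sib_kernel x y)^* = sib_kernel x y.
Proof. by rewrite /sib_kernel rmorphB rmorphM /= fmorphV !rmorph_nat. Qed.

(** The row of [sib_kernel] at [x] vanishes off the siblings of [x], so a sum over such a
    duplicate-free list is the full sum over the tree. *)
Definition sib_closed (W : seq X) (x : X) := forall t, c t = c x -> t \in W.

Lemma sum_siblings (W : seq X) x (F : X -> C) : uniq W -> sib_closed W x ->
  \sum_(t <- W) (c x == c t)%:R * F t = \sum_(t <- ch (c x)) F t.
Proof.
move=> uW Wx; have [uc _ hc] := chP (c x).
rewrite (bigID (fun t => c x == c t)) /= [X in _ + X]big1 ?addr0; last first.
  by move=> t /negbTE ->; rewrite mul0r.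
rewrite -big_filter (perm_big (ch (c x))) /=; last first.
  apply: uniq_perm => //; first exact: filter_uniq.
  move=> t; rewrite mem_filter hc eq_sym; case: eqP => //= e; apply: Wx; exact: e.
by apply: eq_big_seq => t; rewrite hc => /eqP ->; rewrite eqxx mul1r.
Qed.

(** Identity minus the average over a class of q siblings kills the constants on that class. *)
Lemma sum_kernel_siblings x y : \sum_(t <- ch (c x)) sib_kernel y t = 0.
Proof.
have [uc sc hc] := chP (c x); rewrite sumrB -mulr_sumr.
have -> : \sum_(t <- ch (c x)) (c y == c t)%:R = Q * (c y == c x)%:R.
  rewrite (eq_big_seq (fun=> (c y == c x)%:R)) => [|t]; last by rewrite hc => /eqP ->.
  by rewrite big_const_seq count_predT sc iter_addr_0 mulr_natl.
rewrite mulrA mulVf // mul1r -natr_sum.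
have -> : (\sum_(t <- ch (c x)) (y == t) = (c y == c x))%N; last by rewrite subrr.
rewrite -big_mkcond sum1_count -hc -count_uniq_mem //.
by apply: eq_count => t /=; rewrite eq_sym.
Qed.

Lemma sum_delta (W : seq X) x (F : X -> C) : uniq W -> x \in W ->
  \sum_(t <- W) (x == t)%:R * F t = F x.
Proof.
move=> uW xW; rewrite (bigD1_seq x) //= eqxx mul1r big1 ?addr0 // => t.
by rewrite eq_sym => /negbTE ->; rewrite mul0r.
Qed.

Lemma sib_kernel_proj (W : seq X) x y : uniq W -> sib_closed W x ->
  \sum_(t <- W) sib_kernel x t * sib_kernel y t = sib_kernel x y.
Proof.
move=> uW Wx; under eq_bigr do rewrite mulrBl -mulrA.
rewrite sumrB -mulr_sumr sum_siblings // sum_kernel_siblings mulr0 subr0.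
by rewrite sum_delta //; [rewrite sib_kernelC | exact: Wx].
Qed.

(** Closure is required of one family only, since its rows already vanish outside [W]. *)
Lemma sib_kernel_proj_sum (W : seq X) (I J : eqType) (r1 : seq I) (r2 : seq J)
    (P1 : pred I) (P2 : pred J) (al : I -> C) (be : J -> C) (x : I -> X) (y : J -> X) :
  uniq W -> (forall i, i \in r1 -> P1 i -> sib_closed W (x i)) ->
  \sum_(t <- W) (\sum_(i <- r1 | P1 i) al i * sib_kernel (x i) t)
              * (\sum_(j <- r2 | P2 j) be j * sib_kernel (y j) t)
  = \sum_(i <- r1 | P1 i) \sum_(j <- r2 | P2 j) al i * be j * sib_kernel (x i) (y j).
Proof.
move=> uW Wx; under eq_bigr do rewrite big_distrl /=.
rewrite exchange_big /= big_seq_cond [RHS]big_seq_cond; apply: eq_bigr => i /andP[ir Pi].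
under eq_bigr do rewrite big_distrr /=.
rewrite exchange_big /=; apply: eq_bigr => j Pj.
rewrite -(sib_kernel_proj (y j) uW (Wx i ir Pi)) mulr_sumr.
by apply: eq_bigr => t _; ring.
Qed.

Definition sib_cover (s : seq X) (N : nat) : seq X :=
  undup (flatten [seq ch (c (iter i c x)) | x <- s, i <- iota 0 N]).

Lemma sib_cover_closed (s : seq X) N x i : x \in s -> (i < N)%N ->
  sib_closed (sib_cover s N) (iter i c x).
Proof.
move=> xs iN t ct; rewrite mem_undup; apply/flattenP; exists (ch (c (iter i c x))).
  by apply/allpairsP; exists (x, i); rewrite mem_iota.
by have [_ _ ->] := chP (c (iter i c x)); apply/eqP.
Qed.

Variables (d : X -> X -> nat).
Hypothesis (dP : forall x y m n, first_merge c x y m n -> d x y = (m + n)%N).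
Hypothesis (cinj : forall x, injective (fun i => iter i c x)).
Hypothesis (merge : forall x y, exists m n, first_merge c x y m n).
Hypothesis (mergeP : forall x y m n i j, first_merge c x y m n ->
  (iter i c x = iter j c y) <-> exists k, i = (m + k)%N /\ j = (n + k)%N).

(** The pairs (i, j) at which the rays agree form one diagonal starting at (m, n), and
    [N - maxn m n] of its points lie in the square. *)
Lemma sum_merge x y m n N (F : nat -> nat -> C) : first_merge c x y m n ->
  \sum_(i < N) \sum_(j < N) F i j * (iter i c x == iter j c y)%:R
  = \sum_(k < N - maxn m n) F (m + k)%N (n + k)%N.
Proof.
move=> fm.
have e (i j : 'I_N) : (iter i c x == iter j c y)%:R =
    \sum_(k < N - maxn m n) (i == m + k :> nat)%:R * (j == n + k :> nat)%:R :> C.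
  have [/eqP h|h] := boolP (_ == _).
    have [k [ik jk]] := (mergeP i j fm).1 h.
    have kK : (k < N - maxn m n)%N by have := ltn_ord i; have := ltn_ord j; lia.
    rewrite (bigD1 (Ordinal kK)) //= ik jk !eqxx mulr1 big1 ?addr0 // => k' nk.
    rewrite eqn_add2l; case: eqP => [ek|_]; last by rewrite mul0r.
    by case/eqP: nk; apply: val_inj.
  rewrite big1 // => k _; case: eqP => [ik|_]; last by rewrite mul0r.
  case: eqP => [jk|_]; last by rewrite mulr0.
  by case/eqP: h; apply/(mergeP i j fm); exists k.
under eq_bigr do under eq_bigr do rewrite e mulr_sumr.
under eq_bigr do rewrite exchange_big /=.
rewrite exchange_big /=; apply: eq_bigr => k _.
have kN : (m + k < N)%N by have := ltn_ord k; lia.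
have kN' : (n + k < N)%N by have := ltn_ord k; lia.
rewrite (bigD1 (Ordinal kN)) //= [X in _ + X]big1 ?addr0; last first.
  move=> i ni; rewrite big1 // => j _; case: eqP => [ei|_]; last by rewrite mul0r mulr0.
  by case/eqP: ni; apply: val_inj.
rewrite (bigD1 (Ordinal kN')) //= !eqxx !mulr1 big1 ?addr0 // => j nj.
case: eqP => [ej|_]; last by rewrite !mulr0.
by case/eqP: nj; apply: val_inj.
Qed.

Variable s : C.
Local Notation G := (cheb q s).
Local Notation kap := (kappa q s).
Local Notation phin := (sph q s).

Definition trunc_kernel N x y :=
  \sum_(i < N) \sum_(j < N) G i.+1 * G j.+1 * sib_kernel (iter i c x) (iter j c y).

Lemma trunc_kernelE x y m n N : first_merge c x y m n -> (maxn m n <= N)%N ->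
  kap * trunc_kernel N x y = phin (m + n)
    - phin (m + n + (N - maxn m n).*2)
    - kap * Q^-1 * (G (m + (N - maxn m n)) * G (n + (N - maxn m n))).
Proof.
move=> fm mnN; set K := (N - maxn m n)%N.
(* In the part with equal parents both indices are raised by one, so it runs below [N.+1]; the added
   row and column vanish because [cheb 0 = 0]. *)
have -> : trunc_kernel N x y =
    \sum_(k < K) G (m + k).+1 * G (n + k).+1 - Q^-1 * \sum_(k < K.+1) G (m + k) * G (n + k).
  have -> : K.+1 = (N.+1 - maxn m n)%N by rewrite subSn.
  rewrite -(sum_merge N (fun i j => G i.+1 * G j.+1) fm) -(sum_merge N.+1 (fun i j => G i * G j) fm).
  rewrite big_ord_recl [X in Q^-1 * (X + _)]big1 ?add0r; last by move=> j _; rewrite !mul0r.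
  rewrite mulr_sumr -sumrB; apply: eq_bigr => i _.
  rewrite big_ord_recl mulr0 mul0r add0r mulr_sumr -sumrB; apply: eq_bigr => j _.
  by rewrite /sib_kernel -!iterS; ring.
elim: K => [|K IH].
  by rewrite big_ord0 big_ord1 !addn0; ring.
rewrite [\sum_(i < K.+1) _]big_ord_recr /= [\sum_(i < K.+2) _]big_ord_recr /=.
set A := \sum_(i < K) _ in IH *; set B := \sum_(i < K.+1) _ in IH *.
have h := sph_diff q0 q1 s (m + n + K.*2).
have h2 := chebD q s (m + K) (n + K).
have e2 : (m + K + (n + K) = m + n + K.*2)%N by lia.
rewrite e2 in h2; rewrite h2 in h.
have -> : (m + n + (K.+1).*2 = (m + n + K.*2).+2)%N by rewrite doubleS !addnS.
rewrite !addnS -(subrK (phin (m + n + K.*2).+2) (phin (m + n + K.*2))) h in IH *.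
transitivity (kap * (A - Q^-1 * B) + kap * (1 - Q^-1) * (G (m + K).+1 * G (n + K).+1)); first by ring.
rewrite IH; ring.
Qed.

Lemma trunc_kernel_cvg x y (e : R) : 0 < e ->
  (forall e : R, 0 < e -> exists n0, forall n, (n0 <= n)%N -> cabs (G n) <= e) ->
  (forall e : R, 0 < e -> exists n0, forall n, (n0 <= n)%N -> cabs (phin n) <= e) ->
  exists N0, forall N, (N0 <= N)%N ->
    cabs (phin (d x y) - kap * trunc_kernel N x y) <= e.
Proof.
move=> e0 hG hphi; have [m [n fm]] := merge x y; rewrite (dP fm).
pose k := cabs (kap * Q^-1); have k0 : 0 <= k by exact: cabs_ge0.
have e2 : 0 < e / 2 by lra.
have ek : 0 < e / 2 / (1 + k) by rewrite divr_gt0 //; lra.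
have [n1 h1] := hphi _ e2; have [n2 h2] := hG _ ek; have [n3 h3] := hG 1 ltr01.
exists (maxn m n + n1 + n2 + n3)%N => N hN.
rewrite (trunc_kernelE fm); last by lia.
set K := (N - maxn m n)%N; set A := G _ * G _.
have -> : phin (m + n) - (phin (m + n) - phin (m + n + K.*2) - kap * Q^-1 * A) =
   phin (m + n + K.*2) + kap * Q^-1 * A by ring.
apply: le_trans (cabsD _ _) _; rewrite cabsM -/k.
have hA : cabs A <= e / 2 / (1 + k) * 1.
  by rewrite cabsM ler_pM ?cabs_ge0 ?h2 ?h3 //; lia.
have hp : cabs (phin (m + n + K.*2)) <= e / 2 by apply: h1; lia.
have : k * cabs A <= k * (e / 2 / (1 + k)) by rewrite ler_wpM2l // -[X in _ <= X]mulr1.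
have : k * (e / 2 / (1 + k)) <= e / 2.
  rewrite mulrCA ger_pMr // ler_pdivrMr; lra.
lra.
Qed.

(** Distinct points of one ray have distinct parents, so their kernel rows are orthogonal, each of
    squared length 1 - 1/q. *)
Lemma trunc_factor_norm (s0 : seq X) N x : x \in s0 ->
  \sum_(t <- sib_cover s0 N) cabs (\sum_(i < N) G i.+1 * sib_kernel (iter i c x) t) ^+ 2
  = (1 - q%:R^-1) * \sum_(i < N) cabs (G i.+1) ^+ 2.
Proof.
move=> xs; apply: complexI.
rewrite rmorph_sum rmorphM rmorphB rmorph1 fmorphV rmorph_nat rmorph_sum /=.
under eq_bigr do rewrite sqr_cabs rmorph_sum /=.
have -> : \sum_(i < N) (cabs (G i.+1) ^+ 2)%:C = \sum_(i < N) G i.+1 * (G i.+1)^*.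
  by apply: eq_bigr => i _; exact: sqr_cabs.
transitivity (\sum_(t <- sib_cover s0 N) (\sum_(i < N) G i.+1 * sib_kernel (iter i c x) t) *
  (\sum_(j < N) (G j.+1)^* * sib_kernel (iter j c x) t)).
  apply: eq_bigr => t _; congr (_ * _); apply: eq_bigr => i _.
  by rewrite conj_mul conj_sib_kernel.
rewrite sib_kernel_proj_sum ?undup_uniq //; last by move=> i _ _; exact: sib_cover_closed.
rewrite mulr_sumr; apply: eq_bigr => i _.
rewrite (bigD1 i) //= big1 ?addr0; last first.
  move=> j ji; rewrite /sib_kernel -!iterS !(inj_eq (@cinj x)) eqSS eq_sym (inj_eq val_inj).
  by rewrite (negbTE ji) mulr0 subr0 mulr0.
by rewrite /sib_kernel !eqxx mulr1 mulrC.
Qed.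

Lemma eventually_in_list (T : eqType) (l : seq T) (P : T -> nat -> Prop) :
  (forall x, x \in l -> exists N0, forall N, (N0 <= N)%N -> P x N) ->
  exists N0, forall N, (N0 <= N)%N -> forall x, x \in l -> P x N.
Proof.
elim: l => [|y l IH] h; first by exists 0%N.
have [|N1 h1] := IH; first by move=> x xl; apply: h; rewrite inE xl orbT.
have [N2 h2] := h y (mem_head _ _).
exists (maxn N1 N2) => N hN x; rewrite inE => /orP[/eqP ->|xl]; first by apply: h2; lia.
by apply: h1 => //; lia.
Qed.

Lemma schur_upper (S : R) :
  (forall e : R, 0 < e -> exists n0, forall n, (n0 <= n)%N -> cabs (G n) <= e) ->
  (forall e : R, 0 < e -> exists n0, forall n, (n0 <= n)%N -> cabs (phin n) <= e) ->
  (forall N, \sum_(i < N) cabs (G i.+1) ^+ 2 <= S) ->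
  forall a (M : R), (mxnorm a <= M%:E)%E ->
  (mxnorm (schur_mul (fun x y => phin (d x y)) a)
     <= ((1 - q%:R^-1) * cabs kap * S * M)%:E)%E.
Proof.
move=> hG hphi hS a M aM.
have M0 : 0 <= M by rewrite -lee_fin; apply: le_trans aM; apply: mxnorm_ge0.
have S0 : 0 <= S by apply: le_trans (hS 0%N); rewrite big_ord0.
have Qr : (q%:R^-1 : R) <= 1 by rewrite invf_le1 ?ler1n ?ltr0n; lia.
apply: mxnorm_le => s0 u v us lu lv.
apply/ler_addgt0Pr => e e0.
(* The truncated kernels converge only pointwise, but the form involves finitely many pairs. [B] is
   the total weight of their entries, and 1 + B keeps the tolerance defined when [B] is 0. *)
pose B := \sum_(x <- s0) \sum_(y <- s0) cabs ((v x)^* * a x y * u y).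
have B0 : 0 <= B by apply: sumr_ge0 => x _; apply: sumr_ge0 => y _; exact: cabs_ge0.
have e1 : 0 < e / (1 + B) by rewrite divr_gt0 //; lra.
have [N0 hN0] : exists N0, forall N, (N0 <= N)%N -> forall xy, xy \in [seq (x, y) | x <- s0, y <- s0] ->
    cabs (phin (d xy.1 xy.2) - kap * trunc_kernel N xy.1 xy.2) <= e / (1 + B).
  by apply: eventually_in_list => xy _; exact: trunc_kernel_cvg.
have {}hN0 := hN0 N0 (leqnn _).
have -> : bform s0 (schur_mul (fun x y => phin (d x y)) a) u v =
   kap * bform s0 (schur_mul (trunc_kernel N0) a) u v +
   bform s0 (schur_mul (fun x y => phin (d x y) - kap * trunc_kernel N0 x y) a) u v.
  rewrite /bform mulr_sumr -big_split; apply: eq_bigr => x _ /=.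
  rewrite mulr_sumr -big_split; apply: eq_bigr => y _ /=.
  by rewrite /schur_mul; ring.
apply: le_trans (cabsD _ _) _; apply: lerD.
  rewrite cabsM.
  apply: le_trans (_ : cabs kap * ((1 - q%:R^-1) * S * M * ((l2sq s0 u + l2sq s0 v) / 2)) <= _).
    rewrite ler_wpM2l ?cabs_ge0 //.
    apply: (@schur_factor_bound _ _ _ _ (sib_cover s0 N0)
      (fun x t => \sum_(i < N0) G i.+1 * sib_kernel (iter i c x) t)) => //.
    - by rewrite mulr_ge0 // subr_ge0.
    - move=> x y xs ys; rewrite sib_kernel_proj_sum ?undup_uniq //.
      by move=> i _ _; exact: sib_cover_closed.
    - by move=> x xs; rewrite trunc_factor_norm // ler_wpM2l ?subr_ge0.
  have -> : (1 - q%:R^-1) * cabs kap * S * M = cabs kap * ((1 - q%:R^-1) * S * M * 1) by ring.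
  rewrite ler_wpM2l ?cabs_ge0 // ler_wpM2l; [by [] | by rewrite !mulr_ge0 // subr_ge0 | lra].
apply: le_trans (_ : e / (1 + B) * B <= _); last first.
  by rewrite mulrAC ler_pdivrMr; nra.
apply: le_trans (cabs_sum _ _ _) _; rewrite mulr_sumr big_seq [X in _ <= X]big_seq.
apply: ler_sum => x xs; apply: le_trans (cabs_sum _ _ _) _.
rewrite mulr_sumr big_seq [X in _ <= X]big_seq; apply: ler_sum => y ys.
rewrite /schur_mul [_^* * _]mulrCA -[_ * _ * u y]mulrA cabsM ler_wpM2r ?cabs_ge0 //.
by apply: (hN0 (x, y)); apply/allpairsP; exists (x, y).
Qed.

End Kernel.

(** * Lower bound *)

Lemma flatten_map_uniq (S T : eqType) (f : S -> seq T) (s : seq S) :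
  uniq s -> (forall x, uniq (f x)) ->
  (forall x y t, t \in f x -> t \in f y -> x = y) -> uniq (flatten [seq f x | x <- s]).
Proof.
move=> + uf df; elim: s => //= x s IH /andP[xs us].
rewrite cat_uniq uf IH // andbT /=; apply/hasPn => t /flattenP[_ /mapP[y ys ->] ty].
by apply: contra xs => tx; rewrite (df x y t).
Qed.

Section Test.
Variables (R : realType) (X : eqType) (q : nat) (c : X -> X) (ch : X -> seq X).
Hypothesis (q2 : (2 <= q)%N).
Hypothesis (chP : forall y, [/\ uniq (ch y), size (ch y) = q & forall x, (x \in ch y) = (c x == y)]).
Local Notation C := R[i].
Local Notation Q := (q%:R : C).

Let q0 : Q != 0. Proof. by rewrite pnatr_eq0; lia. Qed.
Let q1 : Q + 1 != 0. Proof. by rewrite natr1 pnatr_eq0. Qed.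
Variables (d : X -> X -> nat).
Hypothesis (dP : forall x y m n, first_merge c x y m n -> d x y = (m + n)%N).
Hypothesis (cinj : forall x, injective (fun i => iter i c x)).

Fixpoint desc (k : nat) (w : X) : seq X :=
  if k is k'.+1 then flatten [seq desc k' t | t <- ch w] else [:: w].

Lemma mem_desc k w x : (x \in desc k w) = (iter k c x == w).
Proof.
elim: k w => [|k IH] w /=; first by rewrite inE.
have [_ _ hc] := chP w.
apply/flattenP/eqP => [[_ /mapP[t + ->]]|e].
  by rewrite IH hc => /eqP <- /eqP ->.
exists (desc k (iter k c x)); last by rewrite IH.
by apply/mapP; exists (iter k c x) => //; rewrite hc e.
Qed.

Lemma desc_uniq k w : uniq (desc k w).
Proof.
elim: k w => //= k IH w; have [uc _ _] := chP w.
by apply: flatten_map_uniq => // x y t; rewrite !mem_desc => /eqP <- /eqP <-.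
Qed.

Lemma size_desc k w : size (desc k w) = (q ^ k)%N.
Proof.
elim: k w => //= k IH w; have [_ sc _] := chP w.
rewrite size_flatten /shape -map_comp.
rewrite (eq_map (_ : _ =1 fun=> (q ^ k)%N)); last by move=> t; rewrite /= IH.
by rewrite sumnE big_map big_const_seq count_predT sc iter_addn_0 expnS mulnC.
Qed.

Lemma sum_descD p i w (F : X -> C) : \sum_(x <- desc (p + i) w) F x
  = \sum_(t <- desc p w) \sum_(x <- desc i t) F x.
Proof.
elim: p w => [|p IH] w; first by rewrite big_seq1.
by rewrite addSn /= !big_flatten !big_map; apply: eq_bigr => t _.
Qed.

Lemma desc_closed p o w : w \in desc p.+1 o -> sib_closed c (desc p.+1 o) w.
Proof. by rewrite mem_desc => + t ct; rewrite mem_desc !iterSr ct. Qed.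

Variable s : C.
Local Notation G := (cheb q s).
Local Notation kap := (kappa q s).
Local Notation phin := (sph q s).

Definition desc_sum w w' i j := \sum_(x <- desc i w) \sum_(y <- desc j w') phin (d x y).

Lemma desc_sum_const w w' i j n :
  (forall x y, iter i c x = w -> iter j c y = w' -> d x y = n) ->
  desc_sum w w' i j = Q ^+ (i + j) * phin n.
Proof.
move=> h; rewrite /desc_sum (eq_big_seq (fun=> Q ^+ j * phin n)).
  rewrite big_const_seq count_predT size_desc iter_addr_0 -[_ *+ _]mulr_natl natrX exprD; ring.
move=> x; rewrite mem_desc => /eqP xw; rewrite (eq_big_seq (fun=> phin n)).
  by rewrite big_const_seq count_predT size_desc iter_addr_0 -[_ *+ _]mulr_natl natrX.
by move=> y; rewrite mem_desc => /eqP yw; rewrite (h x y).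
Qed.

Lemma desc_sum_sib w w' i j : w <> w' -> c w = c w' ->
  desc_sum w w' i j = Q ^+ (i + j) * phin (i + j).+2.
Proof.
move=> ne e; apply: desc_sum_const => x y xw yw.
rewrite (@dP x y i.+1 j.+1) ?addSn ?addnS //.
by split=> [|_ _] /=; rewrite xw yw.
Qed.

Lemma sum_siblings_const (w : X) (F : X -> C) (A B : C) :
  F w = A -> (forall t, t <> w -> c t = c w -> F t = B) ->
  \sum_(t <- ch (c w)) F t = A + (Q - 1) * B.
Proof.
move=> Fw Ft; have [uc sc hc] := chP (c w).
have wc : w \in ch (c w) by rewrite hc.
rewrite (bigD1_seq w) //= Fw; congr (_ + _).
rewrite -big_filter (eq_big_seq (fun=> B)); last first.
  by move=> t; rewrite mem_filter hc => /andP[/eqP tw /eqP ct]; exact: Ft.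
rewrite big_const_seq count_predT iter_addr_0 -[_ *+ _]mulr_natl; congr (_ * _).
rewrite -rem_filter // size_rem // sc.
by case: q q2 => // n _; rewrite -natr1 addrK.
Qed.

(** Both generations are split over the children of [w]: equal children fall under the induction
    hypothesis, distinct ones contribute a constant, and [sph_chebM] recombines the two. When i or j
    is 0 the distance is constant. *)
Lemma desc_sum_diag w i j :
  desc_sum w w i j = Q ^+ (i + j) * (phin (i + j).+2 + kap * (G i.+1 * G j.+1)).
Proof.
have base n : phin n = phin n.+2 + kap * (G 1 * G n.+1).
  by rewrite mul1r -(sph_diff q0 q1) addrC subrK.
elim: i j w => [|i IH] [|j] w.
- rewrite (@desc_sum_const w w 0 0 0) => [|x y <- e]; first by rewrite {1}base.
  by rewrite (@dP _ _ 0 0).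
- rewrite (@desc_sum_const w w 0 j.+1 j.+1) => [|x y <- e]; first by rewrite {1}base.
  by rewrite (@dP _ _ 0 j.+1).
- rewrite (@desc_sum_const w w i.+1 0 i.+1) => [|x y e ey].
    by rewrite {1}base addn0 [G 1 * _]mulrC.
  by rewrite (@dP _ _ i.+1 0) ?addn0 //; split=> //; rewrite e -ey.
have -> : desc_sum w w i.+1 j.+1 =
    \sum_(t <- ch w) \sum_(t' <- ch w) desc_sum t t' i j.
  rewrite /desc_sum /= big_flatten big_map; apply: eq_bigr => t _.
  rewrite [RHS]exchange_big; apply: eq_bigr => x _.
  by rewrite big_flatten big_map.
have [uc sc hc] := chP w.
rewrite (eq_big_seq (fun=> Q ^+ (i + j) * (phin (i + j).+2 + kap * (G i.+1 * G j.+1)) +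
   (Q - 1) * (Q ^+ (i + j) * phin (i + j).+2))); last first.
  move=> t; rewrite hc => /eqP <-; apply: sum_siblings_const; first exact: IH.
  by move=> t' ne e; apply: desc_sum_sib => //; apply: nesym.
rewrite big_const_seq count_predT iter_addr_0 -[_ *+ _]mulr_natl sc.
have h := sph_chebM q0 q1 s i.+1 j.+1.
rewrite h !addSn !addnS !exprS; field.
exact: q0.
Qed.

(** Descendants are grouped by their ancestors i and j steps up. Ancestors at different depths are
    not siblings; at equal depth the kernel takes the difference between the diagonal and the
    sibling sums, in which the values of phi cancel. *)
Lemma desc_sum_kernel o k l i j : (i < k)%N -> (j < l)%N ->
  \sum_(x <- desc k o) \sum_(y <- desc l o)
     phin (d x y) * sib_kernel R q c (iter i c x) (iter j c y)
  = (k - i == l - j)%N%:R * (Q ^+ (k + j) * ((1 - Q^-1) * (kap * (G i.+1 * G j.+1)))).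
Proof.
(* As i < k and j < l, the ancestors lie strictly below [o], so their siblings are descendants of
   [o] too. *)
move=> ik jl; pose p := (k - i).-1; pose p' := (l - j).-1.
have -> : k = (p.+1 + i)%N by rewrite /p; lia.
have -> : l = (p'.+1 + j)%N by rewrite /p'; lia.
rewrite !addnK eqSS sum_descD.
transitivity (\sum_(w <- desc p.+1 o) \sum_(w' <- desc p'.+1 o)
    sib_kernel R q c w w' * desc_sum w w' i j).
  apply: eq_bigr => w _; under eq_bigr do rewrite sum_descD.
  rewrite exchange_big; apply: eq_bigr => w' _ /=.
  rewrite /desc_sum mulr_sumr; apply: eq_big_seq => x; rewrite mem_desc => /eqP xw.
  rewrite mulr_sumr; apply: eq_big_seq => y; rewrite mem_desc => /eqP yw.
  by rewrite xw yw mulrC.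
have [e|ne] := eqVneq p p'; last first.
  rewrite mul0r big_seq big1 // => w; rewrite mem_desc iterSr => /eqP wp.
  rewrite big_seq big1 // => w'; rewrite mem_desc iterSr => /eqP wp'.
  have cw : (c w == c w') = false.
    apply/eqP => cw; case/eqP: ne; apply: (@cinj (c w)).
    by rewrite /= wp cw wp'.
  rewrite /sib_kernel cw; have -> : (w == w') = false.
    by apply/eqP => ww; rewrite ww eqxx in cw.
  by rewrite mulr0 subr0 mul0r.
rewrite -e mul1r.
rewrite (eq_big_seq (fun=> Q ^+ (i + j) * ((1 - Q^-1) * (kap * (G i.+1 * G j.+1))))).
  rewrite big_const_seq count_predT size_desc iter_addr_0 -[_ *+ _]mulr_natl natrX -addnA [Q ^+ (p.+1 + _)]exprD.
  by rewrite mulrA.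
move=> w wD.
under eq_bigr do rewrite /sib_kernel mulrBl -mulrA.
rewrite sumrB -mulr_sumr (@sum_delta _ _ _ _ (fun t => desc_sum w t i j)) ?desc_uniq //.
rewrite (@sum_siblings _ _ _ _ _ chP _ _ (fun t => desc_sum w t i j)) ?desc_uniq //; last exact: desc_closed.
rewrite (@sum_siblings_const w _ (desc_sum w w i j) (Q ^+ (i + j) * phin (i + j).+2)) //; last first.
  by move=> t ne' et; apply: desc_sum_sib => //; apply: nesym.
rewrite desc_sum_diag; field; exact: q0.
Qed.

End Test.

Lemma sqr_sum_le (R : realFieldType) (N : nat) (x y : nat -> R) :
  \sum_(i < N) x i ^+ 2 <= 1 -> (\sum_(i < N) x i * y i) ^+ 2 <= \sum_(i < N) y i ^+ 2.
Proof.
move=> x1; set Z := \sum_(i < N) x i * y i.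
have h : 0 <= \sum_(i < N) (y i - Z * x i) ^+ 2 by apply: sumr_ge0 => i _; exact: sqr_ge0.
have e (W : R) : \sum_(i < N) (y i - W * x i) ^+ 2 =
    \sum_(i < N) y i ^+ 2 - 2 * W * (\sum_(i < N) x i * y i) + W ^+ 2 * \sum_(i < N) x i ^+ 2.
  rewrite !mulr_sumr -sumrB -big_split; apply: eq_bigr => i _ /=; ring.
rewrite e -/Z in h.
have := ler_wpM2l (sqr_ge0 Z) x1; nra.
Qed.

(** * Contractivity of the test matrix *)

Section Energy.
Variables (R : realType) (X : eqType).
Local Notation C := R[i].

(** For P = P' this is the sum, over the fibres of [f], of the squared modulus of the sum of [w] on
    the fibre. *)
Definition fibre_form (T : eqType) (f : X -> T) (s : seq X) (P P' : pred X) (w : X -> C) : C :=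
  \sum_(x <- s | P x) \sum_(y <- s | P' y) w x * (w y)^* * (f x == f y)%:R.

Lemma fibre_form_ge0 (T : eqType) (f : X -> T) s P w : 0 <= fibre_form f s P P w.
Proof.
have -> : fibre_form f s P P w = \sum_(t <- undup (map f s))
    (\sum_(x <- s | P x) w x * (f x == t)%:R) * (\sum_(x <- s | P x) w x * (f x == t)%:R)^*.
  under [RHS]eq_bigr do rewrite big_distrl /=.
  rewrite [RHS]exchange_big /fibre_form [LHS]big_seq_cond [RHS]big_seq_cond.
  apply: eq_bigr => x /andP[xs _] /=.
  under [RHS]eq_bigr do rewrite rmorph_sum mulr_sumr /=.
  rewrite [RHS]exchange_big; apply: eq_bigr => y _ /=.
  rewrite (bigD1_seq (f x)) ?undup_uniq ?mem_undup ?map_f //= big1 => [|t tf].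
    by rewrite conj_mul rmorph_nat eqxx mulr1 addr0 [f y == _]eq_sym mulrA.
  by rewrite eq_sym (negbTE tf) mulr0 mul0r.
by apply: sumr_ge0 => t _; exact: mul_conjC_ge0.
Qed.

Variables (q : nat) (c : X -> X) (ch : X -> seq X) (dep : X -> nat).
Hypothesis (q2 : (2 <= q)%N).
Hypothesis (chP : forall y, [/\ uniq (ch y), size (ch y) = q & forall x, (x \in ch y) = (c x == y)]).
Hypothesis (dep_c : forall x, dep (c x) = (dep x).-1).
Variable r : R.
Hypothesis (r2 : r ^+ 2 = q%:R^-1).

Lemma dep_iter i x : dep (iter i c x) = (dep x - i)%N.
Proof. by elim: i => [|i IH] /=; rewrite ?subn0 // dep_c IH; lia. Qed.

(** The squared norm of V^i applied to the part of [w] of depth greater than i: V^i sums over i-th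
    descendants with weight q^(-i/2). *)
Definition level_energy (s : seq X) (w : X -> C) (i : nat) : C :=
  q%:R^-1 ^+ i * fibre_form (fun x => iter i c x) s (fun x => i < dep x)%N (fun x => i < dep x)%N w.

(* Equality of the (i+1)-st ancestors forces equal depths, so the terms with
   depth exactly i+1 decouple and form a nonnegative block. *)
Lemma level_energy_le s w i :
  level_energy s w i.+1 <= q%:R^-1 ^+ i.+1 *
    fibre_form (fun x => iter i.+1 c x) s (fun x => i < dep x)%N (fun x => i < dep x)%N w.
Proof.
rewrite /level_energy ler_wpM2l ?exprn_ge0 ?invr_ge0 //.
have -> : fibre_form (fun x => iter i.+1 c x) s (fun x => i < dep x)%N (fun x => i < dep x)%N w =
   fibre_form (fun x => iter i.+1 c x) s (fun x => i.+1 < dep x)%N (fun x => i.+1 < dep x)%N w +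
   fibre_form (fun x => iter i.+1 c x) s (fun x => dep x == i.+1)%N (fun x => dep x == i.+1)%N w.
  have cross x y : (i.+1 < dep x)%N -> dep y == i.+1 -> (iter i.+1 c x == iter i.+1 c y) = false.
    by move=> dx /eqP dy; apply/eqP => /(congr1 dep); rewrite !dep_iter; lia.
  rewrite /fibre_form (bigID (fun x => i.+1 < dep x)%N) /=; congr (_ + _).
    apply: eq_big => x; first by apply/andP/idP => [[]|] //; lia.
    move=> /andP[_ dx]; rewrite (bigID (fun x => i.+1 < dep x)%N) /= addrC big1 ?add0r.
      by apply: eq_bigl => y; apply/andP/idP => [[]|] //; lia.
    by move=> y dy; rewrite cross ?mulr0 //; apply/eqP; lia.
  apply: eq_big => x; first by apply/andP/eqP => [[]|] //; lia.
  move=> /andP[dx dx']; rewrite (bigID (fun x => i.+1 < dep x)%N) /= big1 ?add0r.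
    by apply: eq_bigl => y; apply/andP/eqP => [[]|] //; lia.
  by move=> y /andP[_ dy]; rewrite eq_sym cross ?mulr0 //; apply/eqP; lia.
by rewrite lerDl fibre_form_ge0.
Qed.

Lemma level_energy_ge0 s w i : 0 <= level_energy s w i.
Proof. by rewrite mulr_ge0 ?fibre_form_ge0 ?exprn_ge0 ?invr_ge0. Qed.

Lemma level_energy0 s w : uniq s -> level_energy s w 0 <= (l2sq s w)%:C.
Proof.
move=> us; rewrite /level_energy mul1r /fibre_form /l2sq rmorph_sum /= big_mkcond.
rewrite big_seq [X in _ <= X]big_seq; apply: ler_sum => x xs.
rewrite sqr_cabs; case: ifP => dx; last exact: mul_conjC_ge0.
rewrite -big_filter (bigD1_seq x) ?filter_uniq ?mem_filter ?dx //=.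
rewrite eqxx mulr1 big1 ?addr0 // => y; rewrite eq_sym => /negbTE ->.
by rewrite mulr0.
Qed.

(** This is |(1 - UV) f|^2 = |f|^2 - |V f|^2 for f = V^i w. The depth cut-off, which moves with i,
    turns the equality into an inequality; over i the bounds telescope. *)
Lemma level_proj_norm (s W : seq X) w i : uniq W ->
  (forall x, x \in s -> (i < dep x)%N -> sib_closed c W (iter i c x)) ->
  (\sum_(t <- W) cabs (\sum_(x <- s | (i < dep x)%N)
      w x * (r ^+ i)%:C * sib_kernel R q c (iter i c x) t) ^+ 2)%:C
  <= level_energy s w i - level_energy s w i.+1.
Proof.
move=> uW Wc.
apply: (@le_trans _ _ (level_energy s w i - q%:R^-1 ^+ i.+1 *
    fibre_form (fun x => iter i.+1 c x) s (fun x => i < dep x)%N (fun x => i < dep x)%N w)); last first.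
  by rewrite lerB // level_energy_le.
rewrite le_eqVlt; apply/orP; left; apply/eqP.
rewrite rmorph_sum /=.
transitivity (\sum_(t <- W) (\sum_(x <- s | (i < dep x)%N)
      w x * (r ^+ i)%:C * sib_kernel R q c (iter i c x) t) *
   (\sum_(x <- s | (i < dep x)%N)
      ((w x)^* * (r ^+ i)%:C) * sib_kernel R q c (iter i c x) t)).
  apply: eq_bigr => t _; rewrite sqr_cabs; congr (_ * _); rewrite rmorph_sum.
  by apply: eq_bigr => x _ /=; rewrite !conj_mul conj_sib_kernel conj_real.
rewrite (sib_kernel_proj_sum q2 chP) //.
rewrite /level_energy /fibre_form !mulr_sumr -sumrB; apply: eq_bigr => x _.
rewrite !mulr_sumr -sumrB; apply: eq_bigr => y _.
have rr : (r ^+ i)%:C * (r ^+ i)%:C = q%:R^-1 ^+ i :> C.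
  by rewrite -rmorphM /= -expr2 exprAC r2 rmorphXn /= fmorphV rmorph_nat.
have -> : w x * (r ^+ i)%:C * ((w y)^* * (r ^+ i)%:C) = q%:R^-1 ^+ i * (w x * (w y)^*).
  by rewrite -rr; ring.
by rewrite /sib_kernel exprS -!iterS; ring.
Qed.

Variable xi : nat -> C.
Hypothesis (xi1 : forall N, \sum_(i < N) cabs (xi i) ^+ 2 <= 1).

(** The entries of a matrix T with [test_mx] = T T^t, without conjugation; [test_coeff_norm] states
    that T^t is a contraction. *)
Definition test_coeff (x t : X) : C :=
  \sum_(i < dep x) xi i * (r ^+ i)%:C * sib_kernel R q c (iter i c x) t.

(* The operator sum_{i,j} xi_i xi_j U^i (1 - U V) V^j, where U is the isometry
   f |-> q^(-1/2) (f o c) on functions supported in {dep > 0} and V its adjoint. *)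
Definition test_mx (x y : X) : C :=
  \sum_(i < dep x) \sum_(j < dep y)
    xi i * (r ^+ i)%:C * (xi j * (r ^+ j)%:C) * sib_kernel R q c (iter i c x) (iter j c y).

(** Cauchy-Schwarz in i against the sequence [xi] of norm at most 1, separately for each t, leaves
    the level projections, whose norms telescope to at most [level_energy s w 0]. *)
Lemma test_coeff_norm s w : uniq s ->
  \sum_(t <- sib_cover c ch s (\max_(x <- s) dep x)%N) cabs (\sum_(x <- s) w x * test_coeff x t) ^+ 2 <= l2sq s w.
Proof.
move=> us; set N := (\max_(x <- s) dep x)%N; set W := sib_cover c ch s N.
have depN x : x \in s -> (dep x <= N)%N by move=> xs; apply: leq_bigmax_seq.
pose y t i := \sum_(x <- s | (i < dep x)%N)
      w x * (r ^+ i)%:C * sib_kernel R q c (iter i c x) t.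
have e t : \sum_(x <- s) w x * test_coeff x t = \sum_(i < N) xi i * y t i.
  under [RHS]eq_bigr do rewrite mulr_sumr big_mkcond /=.
  rewrite [RHS]exchange_big; apply: eq_big_seq => x xs.
  rewrite -big_mkcond /test_coeff mulr_sumr.
  rewrite (big_ord_widen N (fun i => w x * (xi i * (r ^+ i)%:C * sib_kernel R q c (iter i c x) t)) (depN x xs)).
  by apply: eq_bigr => i _; ring.
apply: (@le_trans _ _ (\sum_(t <- W) \sum_(i < N) cabs (y t i) ^+ 2)).
  apply: ler_sum => t _; rewrite e.
  apply: le_trans (@sqr_sum_le _ N (fun i => cabs (xi i)) (fun i => cabs (y t i)) (xi1 N)).
  have S0 : 0 <= \sum_(i < N) cabs (xi i) * cabs (y t i).
    by apply: sumr_ge0 => i _; rewrite mulr_ge0 ?cabs_ge0.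
  rewrite ler_sqr ?nnegrE ?cabs_ge0 //.
  by apply: le_trans (cabs_sum _ _ _) _; apply: ler_sum => i _; rewrite cabsM.
rewrite exchange_big -lecR rmorph_sum /=.
apply: (@le_trans _ _ (\sum_(i < N) (level_energy s w i - level_energy s w i.+1))).
  apply: ler_sum => i _; apply: level_proj_norm; first exact: undup_uniq.
  move=> x xs idx; apply: sib_cover_closed => //; exact: leq_trans (depN x xs).
apply: le_trans (level_energy0 w us).
have -> M : \sum_(i < M) (level_energy s w i - level_energy s w i.+1) =
    level_energy s w 0 - level_energy s w M.
  elim: M => [|M IHM]; first by rewrite big_ord0 subrr.
  by rewrite big_ord_recr IHM /= addrA subrK.
by rewrite gerBl level_energy_ge0.
Qed.

Lemma test_mx_norm : (mxnorm test_mx <= 1%:E)%E.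
Proof.
apply: mxnorm_le => s u v us lu lv.
pose N := (\max_(x <- s) dep x)%N; pose W := sib_cover c ch s N.
have depN x : x \in s -> (dep x <= N)%N by move=> xs; apply: leq_bigmax_seq.
have -> : bform s test_mx u v = \sum_(t <- W)
   (\sum_(x <- s) (v x)^* * test_coeff x t) * (\sum_(y <- s) u y * test_coeff y t).
  under [RHS]eq_bigr do rewrite big_distrl /=.
  rewrite [RHS]exchange_big; apply: eq_big_seq => x xs /=.
  under [RHS]eq_bigr do rewrite big_distrr /=.
  rewrite [RHS]exchange_big; apply: eq_big_seq => y ys /=.
  transitivity ((v x)^* * (\sum_(t <- W) test_coeff x t * test_coeff y t) * u y).
    congr (_ * _ * _); rewrite (sib_kernel_proj_sum q2 chP) ?undup_uniq //.
    move=> i _ _; apply: sib_cover_closed => //.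
    exact: leq_trans (ltn_ord i) (depN x xs).
  rewrite mulr_sumr mulr_suml; apply: eq_bigr => t _; ring.
apply: le_trans (cabs_sum _ _ _) _.
have h1 := test_coeff_norm u us.
have h2 := test_coeff_norm (fun x => (v x)^*) us.
have l2c : l2sq s (fun x => (v x)^*) = l2sq s v by apply: eq_bigr => x _; rewrite cabs_conj.
rewrite l2c /= -/N -/W in h1 h2.
apply: (@le_trans _ _ (\sum_(t <- W) (2^-1 * cabs (\sum_(x <- s) (v x)^* * test_coeff x t) ^+ 2 +
   2^-1 * cabs (\sum_(y <- s) u y * test_coeff y t) ^+ 2))).
  apply: ler_sum => t _; rewrite cabsM.
  set A := cabs _; set B := cabs _; have := sqr_ge0 (A - B); rewrite sqrrB; lra.
rewrite big_split -!mulr_sumr /=; lra.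
Qed.

End Energy.

(** * Counting the terms of the test form along diagonals *)

Section Counting.
Variables (R : realDomainType) (g : nat -> R).
Hypothesis g0 : forall i, 0 <= g i.

Definition band_sum L := \sum_(k < L) \sum_(l < L) \sum_(i < k) \sum_(j < l)
  (k - i == l - j)%N%:R * (g i * g j).

(** For p < L - M every i < M occurs, with k = i + p + 1 < L. *)
Lemma diagonal_sum_ge L M p : (p < L - M)%N ->
  \sum_(i < M) g i <= \sum_(k < L) \sum_(i < k) (k - i == p.+1)%N%:R * g i.
Proof.
move=> pL.
have inner k : \sum_(i < k) (k - i == p.+1)%N%:R * g i = if (p < k)%N then g (k - p.+1)%N else 0.
  case: ifPn => pk; last by rewrite big1 // => i _; case: eqP => [|_]; rewrite ?mul0r //; lia.
  have h : (k - p.+1 < k)%N by lia.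
  rewrite (bigD1 (Ordinal h)) //= subKn // eqxx mul1r big1 ?addr0 // => i ni.
  case: eqP => [e|_]; rewrite ?mul0r //; case/eqP: ni; apply: val_inj => /=; lia.
under [X in _ <= X]eq_bigr do rewrite inner.
rewrite -[X in _ <= X](big_mkord xpredT (fun k => if (p < k)%N then g (k - p.+1)%N else 0)).
rewrite (big_cat_nat (n := p.+1)) //=; last by lia.
rewrite [X in X + _]big_nat [X in X + _]big1 ?add0r; last by move=> k kp; case: ifP => //; lia.
rewrite -[X in \big[_/_]_(X <= _ < _) _]add0n big_addn (big_cat_nat (n := M)) //=; last by lia.
rewrite -(big_mkord xpredT g) -[X in X <= _]addr0 lerD //.
  by apply: ler_sum => i _; rewrite addnK; case: ifP => //; lia.
by apply: sumr_ge0 => i _; case: ifP.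
Qed.

(** Grouping by the common value p + 1 of k - i and l - j makes [band_sum] a sum of L squares, of
    which the first L - M are full. *)
Lemma band_sum_ge L M : (L - M)%N%:R * (\sum_(i < M) g i) ^+ 2 <= band_sum L.
Proof.
have -> : band_sum L = \sum_(p < L) (\sum_(k < L) \sum_(i < k) (k - i == p.+1)%N%:R * g i) ^+ 2.
  have split (k l i j : nat) : (i < k)%N -> (k < L)%N -> (k - i == l - j)%N%:R =
     \sum_(p < L) (k - i == p.+1)%N%:R * (l - j == p.+1)%N%:R :> R.
    move=> ik kL; have h : ((k - i).-1 < L)%N by lia.
    rewrite (bigD1 (Ordinal h)) //= prednK ?subn_gt0 // eqxx mul1r big1 ?addr0 => [|p np].
      by rewrite eq_sym.
    by case: eqP => [e|_]; rewrite ?mul0r //; case/eqP: np; apply: val_inj => /=; lia.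
  transitivity (\sum_(k < L) \sum_(l < L) \sum_(i < k) \sum_(j < l) \sum_(p < L)
     ((k - i == p.+1)%N%:R * g i) * ((l - j == p.+1)%N%:R * g j)).
    apply: eq_bigr => k _; apply: eq_bigr => l _; apply: eq_bigr => i _; apply: eq_bigr => j _.
    by rewrite (split k l i j) // mulr_suml; apply: eq_bigr => p _; ring.
  under eq_bigr do under eq_bigr do under eq_bigr do rewrite exchange_big /=.
  under eq_bigr do under eq_bigr do rewrite exchange_big /=.
  under eq_bigr do rewrite exchange_big /=.
  rewrite exchange_big /=; apply: eq_bigr => p _.
  rewrite expr2 big_distrl /=; apply: eq_bigr => k _.
  rewrite big_distrr /=; apply: eq_bigr => l _.
  rewrite big_distrl /=; apply: eq_bigr => i _.
  by rewrite big_distrr /=.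
have S0 : 0 <= \sum_(i < M) g i by exact: sumr_ge0.
rewrite (bigID (fun p : 'I_L => (p < L - M)%N)) /= -[X in X <= _]addr0 lerD //; last first.
  by apply: sumr_ge0 => p _; exact: sqr_ge0.
have -> : (L - M)%N%:R * (\sum_(i < M) g i) ^+ 2 =
    \sum_(p < L | (p < L - M)%N) (\sum_(i < M) g i) ^+ 2.
  rewrite -(big_ord_widen L (fun=> (\sum_(i < M) g i) ^+ 2)) ?leq_subr //.
  by rewrite sumr_const card_ord mulr_natl.
apply: ler_sum => p pL; have h := diagonal_sum_ge pL.
by rewrite ler_sqr ?nnegrE // (le_trans S0).
Qed.

End Counting.

(** * Testing against almost invariant vectors; [gamE] fixes the phases of [xi], so nothing
    cancels *)

Section Lower.
Variables (R : realType) (X : eqType) (q : nat) (c : X -> X) (ch : X -> seq X).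
Hypothesis (q2 : (2 <= q)%N).
Hypothesis (chP : forall y, [/\ uniq (ch y), size (ch y) = q & forall x, (x \in ch y) = (c x == y)]).
Variables (d : X -> X -> nat).
Hypothesis (dP : forall x y m n, first_merge c x y m n -> d x y = (m + n)%N).
Hypothesis (cinj : forall x, injective (fun i => iter i c x)).
Variables (o : X) (dep : X -> nat).
Hypothesis (dep_c : forall x, dep (c x) = (dep x).-1).
Hypothesis (dep_desc : forall k x, iter k c x = o -> dep x = k).
Local Notation C := R[i].
Local Notation Q := (q%:R : C).
Variable s : C.
Local Notation G := (cheb q s).
Local Notation kap := (kappa q s).
Local Notation phin := (sph q s).
Variables (r : R) (xi : nat -> C) (gam : nat -> R).
Hypothesis (r0 : 0 <= r) (r2 : r ^+ 2 = q%:R^-1).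
Hypothesis (xi1 : forall N, \sum_(i < N) cabs (xi i) ^+ 2 <= 1).
Hypothesis (gam0 : forall i, 0 <= gam i) (gamE : forall i, xi i * G i.+1 = (gam i)%:C).


Definition test_list L := flatten [seq desc ch k o | k <- index_iota 0 L].

(** On [test_list L] this is the sum of U^k delta_o for k < L, not normalised: generation k has q^k
    vertices of squared weight q^(-k). *)
Definition test_vec (x : X) : C := (r ^+ dep x)%:C.

Lemma sum_test_list (V : nmodType) L (F : X -> V) :
  \sum_(x <- test_list L) F x = \sum_(k < L) \sum_(x <- desc ch k o) F x.
Proof. by rewrite big_flatten big_map big_mkord. Qed.

Lemma test_list_uniq L : uniq (test_list L).
Proof.
apply: flatten_map_uniq; [exact: iota_uniq | by move=> k; apply: desc_uniq chP _ _ |].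
move=> k l x; rewrite !(mem_desc chP) => /eqP e /eqP e'.
by apply: (@cinj x); rewrite /= e e'.
Qed.

Lemma r_pow k : q%:R ^+ k * (r ^+ k) ^+ 2 = 1 :> R.
Proof.
rewrite exprAC r2 -exprMn divff ?expr1n //.
by rewrite pnatr_eq0; lia.
Qed.

Lemma l2sq_test L : l2sq (test_list L) test_vec = L%:R.
Proof.
rewrite /l2sq sum_test_list (eq_bigr (fun=> 1)) ?sumr_const ?card_ord // => k _.
rewrite (eq_big_seq (fun=> (r ^+ k) ^+ 2)) => [|x]; last first.
  rewrite (mem_desc chP) => /eqP /dep_desc dx.
  by rewrite /test_vec dx cabs_real ?exprn_ge0.
by rewrite big_const_seq count_predT (size_desc chP) iter_addr_0 -[_ *+ _]mulr_natl natrX r_pow.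
Qed.

Lemma test_form L :
  bform (test_list L) (schur_mul (fun x y => phin (d x y)) (test_mx q c dep r xi))
    test_vec test_vec = (1 - Q^-1) * kap * (band_sum gam L)%:C.
Proof.
rewrite /bform sum_test_list.
under eq_bigr do under eq_bigr do rewrite sum_test_list.
under eq_bigr do rewrite exchange_big /=.
rewrite rmorph_sum mulr_sumr; apply: eq_bigr => k _ /=.
rewrite rmorph_sum mulr_sumr; apply: eq_bigr => l _ /=.
transitivity (\sum_(x <- desc ch k o) \sum_(y <- desc ch l o) \sum_(i < k) \sum_(j < l)
   (r ^+ (k + l + i + j))%:C * (xi i * xi j) *
   (phin (d x y) * sib_kernel R q c (iter i c x) (iter j c y))).
  apply: eq_big_seq => x; rewrite (mem_desc chP) => /eqP /dep_desc dx.
  apply: eq_big_seq => y; rewrite (mem_desc chP) => /eqP /dep_desc dy.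
  rewrite /schur_mul /test_mx /test_vec dx dy conj_real mulr_sumr mulr_sumr mulr_suml.
  apply: eq_bigr => i _; rewrite mulr_sumr mulr_sumr mulr_suml; apply: eq_bigr => j _.
  by rewrite !exprD !rmorphM /=; ring.
under [LHS]eq_bigr do rewrite exchange_big /=.
under [LHS]eq_bigr do under eq_bigr do rewrite exchange_big /=.
rewrite [LHS]exchange_big rmorph_sum mulr_sumr; apply: eq_bigr => i _ /=.
rewrite [LHS]exchange_big rmorph_sum mulr_sumr; apply: eq_bigr => j _ /=.
under [LHS]eq_bigr do rewrite -mulr_sumr.
rewrite -mulr_sumr (desc_sum_kernel q2 chP dP cinj) //.
case: eqP => [e|_]; last by rewrite !mul0r rmorph0 !mulr0.
rewrite !mul1r [(gam i * gam j)%:C]rmorphM /= -!gamE.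
(* On the surviving terms k - i = l - j, so the four powers of [r] combine to q^(-(k+j)), exactly
   cancelling the factor from [desc_sum_kernel]. *)
have -> : (k + l + i + j = (k + j) * 2)%N by have := ltn_ord i; have := ltn_ord j; lia.
have := congr1 (real_complex R) (r_pow (k + j)).
rewrite rmorphM !rmorphXn rmorph_nat rmorph1 /= exprM => h.
transitivity (((r%:C ^+ (k + j)) ^+ 2 * Q ^+ (k + j)) *
   ((1 - Q^-1) * kap * (xi i * G i.+1 * (xi j * G j.+1)))); first by ring.
by rewrite mulrC [_ ^+ 2 * _]mulrC h mulr1.
Qed.

(** With L = n + M the test loses only the factor n / (n + M), which tends to 1; the Archimedean
    property replaces the limit. *)
Lemma schur_lower (N : R) M :
  (mxnorm (schur_mul (fun x y => phin (d x y)) (test_mx q c dep r xi)) <= N%:E)%E ->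
  (1 - q%:R^-1) * cabs kap * (\sum_(i < M) gam i) ^+ 2 <= N.
Proof.
move=> hN; set A := (1 - q%:R^-1) * cabs kap; set S := (\sum_(i < M) gam i) ^+ 2.
have Qr : (q%:R^-1 : R) <= 1 by rewrite invf_le1 ?ler1n ?ltr0n; lia.
have A0 : 0 <= A by rewrite mulr_ge0 ?cabs_ge0 ?subr_ge0.
have S0 : 0 <= S by exact: sqr_ge0.
have key n : n%:R * (A * S) <= (n + M)%:R * N.
  have := bform_bound test_vec test_vec (test_list_uniq (n + M)) hN.
  rewrite test_form l2sq_test cabsM cabsM.
  have -> : cabs (1 - Q^-1) = 1 - q%:R^-1.
    rewrite -[RHS]cabs_real ?subr_ge0 //; congr cabs.
    by rewrite rmorphB rmorph1 fmorphV rmorph_nat.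
  have B0 : 0 <= band_sum gam (n + M).
    by apply: le_trans (band_sum_ge gam0 (n + M) M); rewrite mulr_ge0.
  rewrite cabs_real // -/A => h.
  have := ler_wpM2l A0 (band_sum_ge gam0 (n + M) M); rewrite addnK -/S; lra.
rewrite leNgt; apply/negP => lt.
have e0 : 0 < A * S - N by lra.
have := archi_boundP (x := M%:R * N / (A * S - N)) .
set n := Num.bound _.
have := key n; rewrite natrD => k1 k2.
have N0 : 0 <= N by rewrite -lee_fin; apply: le_trans hN; exact: mxnorm_ge0.
have /k2 : 0 <= M%:R * N / (A * S - N) by rewrite divr_ge0 ?mulr_ge0 // ltW.
by rewrite ltr_pdivrMr //; lra.
Qed.

End Lower.

Section Depth.
Variables (X : eqType) (c : X -> X) (o : X).
Hypothesis (cinj : forall x, injective (fun i => iter i c x)).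
Hypothesis (cmerge : forall x y, exists m n, iter m c x = iter n c y).

(** If c^m x = c^n o, then m - n depends on [x] only and drops by one under [c]; the depth is its
    truncation at 0. *)
Lemma exists_depth : exists dep : X -> nat,
  (forall x, dep (c x) = (dep x).-1) /\ (forall k x, iter k c x = o -> dep x = k).
Proof.
have [f hf] : {f : X -> nat * nat & forall x, iter (f x).1 c x = iter (f x).2 c o}.
  apply: (@choice _ _ (fun x mn => iter mn.1 c x = iter mn.2 c o)) => x.
  by have [m [n e]] := cmerge x o; exists (m, n).
have hE x m n : iter m c x = iter n c o -> (m + (f x).2 = n + (f x).1)%N.
  move=> e; apply: (@cinj o) => /=.
  by rewrite iterD -hf -iterD addnC iterD e -iterD addnC.
exists (fun x => (f x).1 - (f x).2)%N; split=> [x|k x e].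
  have h := @hE x (f (c x)).1.+1 (f (c x)).2.
  by have {}h := h (etrans (iterSr _ _ _) (hf (c x))); lia.
by have := hE x k 0 e; lia.
Qed.

End Depth.

(** * Complex powers and the removable singularities *)

Section Cpow.
Local Open Scope classical_set_scope.
Variables (R : realType) (Q : R).
Hypothesis Q0 : 0 < Q.
Local Notation C := R[i].
Implicit Types v w z : C.

Lemma cpowD v w : cpow Q (v + w) = cpow Q v * cpow Q w.
Proof.
case: v => a b; case: w => x y; rewrite /cpow /= powRD ?(gt_eqF Q0) ?implybT //.
rewrite mulrDl cosD sinD rmorphM /= mulrACA; congr (_ * _).
by apply/eqP; rewrite eq_complex /= eqxx /=; apply/eqP; ring.
Qed.

Lemma cpow0 : cpow Q 0 = 1.
Proof. by rewrite /cpow /= powRr0 mul0r cos0 sin0 mul1r. Qed.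

Lemma cabs_cpow w : cabs (cpow Q w) = powR Q (complex.Re w).
Proof.
by rewrite cabsM cabs_real ?powR_ge0 // /cabs /= cos2Dsin2 sqrtr1 mulr1.
Qed.

Lemma cpow_neq0 w : cpow Q w != 0.
Proof. by rewrite -cabs_eq0 cabs_cpow gt_eqF ?powR_gt0. Qed.

Lemma cpowN w : cpow Q (- w) = (cpow Q w)^-1.
Proof.
by apply: (mulfI (cpow_neq0 w)); rewrite -cpowD subrr cpow0 divff ?cpow_neq0.
Qed.

Lemma cpow1 : cpow Q 1 = Q%:C.
Proof. by rewrite /cpow /= powRr1 ?ltW // mul0r cos0 sin0 mulr1. Qed.

Lemma cpowMn w n : cpow Q (w * n%:R) = cpow Q w ^+ n.
Proof.
elim: n => [|n IH]; first by rewrite mulr0 cpow0.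
by rewrite -natr1 mulrDr mulr1 cpowD IH exprSr.
Qed.

Definition cont_at (f : C -> C) z := forall e : R, 0 < e ->
  exists2 h : R, 0 < h & forall w, cabs (w - z) <= h -> cabs (f w - f z) <= e.

Lemma cont_at_cst k z : cont_at (fun=> k) z.
Proof. by move=> e e0; exists 1 => // w _; rewrite subrr cabs0 ltW. Qed.

Lemma cont_at_id z : cont_at id z.
Proof. by move=> e e0; exists e. Qed.

Lemma cont_atD f g z : cont_at f z -> cont_at g z -> cont_at (fun w => f w + g w) z.
Proof.
move=> hf hg e e0; have e2 : 0 < e / 2 by lra.
have [a a0 ha] := hf _ e2; have [b b0 hb] := hg _ e2.
exists (Num.min a b); first by rewrite lt_min a0.
move=> w; rewrite le_min => /andP[/ha wa /hb wb].
have -> : f w + g w - (f z + g z) = (f w - f z) + (g w - g z) by ring.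
by apply: le_trans (cabsD _ _) _; lra.
Qed.

Lemma cont_atM f g z : cont_at f z -> cont_at g z -> cont_at (fun w => f w * g w) z.
Proof.
move=> hf hg e e0.
pose k := 1 + cabs (f z) + cabs (g z).
have k1 : 1 <= k by rewrite /k -addrA lerDl addr_ge0 ?cabs_ge0.
have k0 : 0 < k by lra.
have d0 : 0 < Num.min 1 (e / (2 * k)) by rewrite lt_min ltr01 divr_gt0 // mulr_gt0.
have [a a0 ha] := hf _ d0; have [b b0 hb] := hg _ d0.
exists (Num.min a b); first by rewrite lt_min a0.
move=> w; rewrite le_min => /andP[/ha + /hb]; rewrite !le_min => /andP[f1 fe] /andP[g1 ge].
have -> : f w * g w - f z * g z = (f w - f z) * g w + f z * (g w - g z) by ring.
have gw : cabs (g w) <= 1 + cabs (g z).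
  by rewrite -(subrK (g z) (g w)); apply: le_trans (cabsD _ _) _; rewrite lerD2r.
apply: le_trans (cabsD _ _) _; rewrite !cabsM.
have ek : e / (2 * k) * k = e / 2 by field; rewrite gt_eqF.
have h1 : cabs (f w - f z) * cabs (g w) <= e / (2 * k) * (1 + cabs (g z)).
  by apply: ler_pM; rewrite ?cabs_ge0.
have h2 : cabs (f z) * cabs (g w - g z) <= cabs (f z) * (e / (2 * k)).
  by rewrite ler_wpM2l ?cabs_ge0.
have : e / (2 * k) * (1 + cabs (g z)) + cabs (f z) * (e / (2 * k)) = e / (2 * k) * k.
  by rewrite /k; ring.
lra.
Qed.

Lemma cont_at_comp f g z : cont_at f z -> cont_at g (f z) -> cont_at (fun w => g (f w)) z.
Proof.
move=> hf hg e /hg[a a0 ha]; have [b b0 hb] := hf _ a0.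
by exists b => // w /hb /ha.
Qed.

Lemma cabs_Re w : `|complex.Re w| <= cabs w.
Proof. by case: w => a b; rewrite /cabs /= -[X in X <= _]sqrtr_sqr ler_wsqrtr // lerDl sqr_ge0. Qed.

Lemma cabs_Im w : `|complex.Im w| <= cabs w.
Proof. by case: w => a b; rewrite /cabs /= -[X in X <= _]sqrtr_sqr ler_wsqrtr // lerDr sqr_ge0. Qed.

Lemma cont_at_real (p : C -> R) (g : R -> R) z :
  (forall v w, `|p v - p w| <= cabs (v - w)) -> {for p z, continuous g} ->
  cont_at (fun w => (g (p w))%:C) z.
Proof.
move=> hp /cvgrPdist_le hg e e0.
have [h /= h0 hh] := hg e e0.
exists (h / 2); first by rewrite divr_gt0.
move=> w wz; rewrite -rmorphB /cabs /= expr0n addr0 sqrtr_sqr distrC; apply: hh => /=.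
rewrite distrC; apply: le_lt_trans (hp _ _) _; apply: le_lt_trans wz _; lra.
Qed.

Lemma cont_at_cpow z : cont_at (cpow Q) z.
Proof.
have hR v w : `|complex.Re v - complex.Re w| <= cabs (v - w).
  by case: v w => [a b] [x y]; exact: (cabs_Re ((a - x) +i* (b - y))).
have hI v w : `|complex.Im v - complex.Im w| <= cabs (v - w).
  by case: v w => [a b] [x y]; exact: (cabs_Im ((a - x) +i* (b - y))).
have -> : cpow Q = fun w => (powR Q (complex.Re w))%:C *
    ((cos (complex.Im w * ln Q))%:C + 'i%C * (sin (complex.Im w * ln Q))%:C).
  apply/funext => w; rewrite /cpow; congr (_ * _).
  by apply/eqP; rewrite eq_complex /=; apply/andP; split; apply/eqP; ring.
apply: cont_atM.
  apply: (cont_at_real (g := fun t => powR Q t)) hR _.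
  have -> : (fun t => powR Q t) = (fun t => expR (t * ln Q)).
    by apply/funext => t; rewrite /powR gt_eqF.
  apply: continuous_comp; last exact: continuous_expR.
  exact: mulrr_continuous.
apply: cont_atD.
  apply: (cont_at_real (g := fun t => cos (t * ln Q))) hI _.
  apply: continuous_comp; last exact: continuous_cos.
  exact: mulrr_continuous.
apply: cont_atM; first exact: cont_at_cst.
apply: (cont_at_real (g := fun t => sin (t * ln Q))) hI _.
apply: continuous_comp; last exact: continuous_sin.
exact: mulrr_continuous.
Qed.

Lemma cabs_triangle u v w : cabs (u - v) <= cabs (u - w) + cabs (w - v).
Proof. by rewrite -(subrKA w) cabsD. Qed.

Lemma lim_punctured (f g : C -> C) z (h : R) : 0 < h -> cont_at g z ->
  (forall w, w != z -> cabs (w - z) <= h -> f w = g w) ->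
  lim (f w @[w --> z^']) = g z.
Proof.
move=> h0 hg fg; apply: cvg_lim.
  (* Uniqueness of limits: distinct points are separated by balls of half their distance. *)
  move=> u v cl; apply/eqP/negPn/negP => uv.
  have e0 : 0 < cabs (u - v) by rewrite lt_def cabs_eq0 subr_eq0 uv cabs_ge0.
  have e2 : (0 : C) < (cabs (u - v) / 2)%:C by rewrite ltcR; lra.
  have [||t [tu tv]] := cl (ball_ Num.norm u (cabs (u - v) / 2)%:C) (ball_ Num.norm v (cabs (u - v) / 2)%:C).
  - by exists (cabs (u - v) / 2)%:C.
  - by exists (cabs (u - v) / 2)%:C.
  move: tu tv; rewrite /= !normc_cabs !ltcR -[cabs (v - t)]cabsN opprB => h1 h2.
  have := @cabs_triangle u v t; lra.
move=> A [e /= e0 eA].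
have er : e = (complex.Re e)%:C by rewrite RRe_real // gtr0_real.
move: e0; rewrite er ltcR => r0.
have r2 : 0 < complex.Re e / 2 by lra.
have [b b0 hb] := hg _ r2.
exists (Num.min h b)%:C; first by rewrite /= ltcR lt_min h0.
move=> w /=; rewrite -opprB normrN normc_cabs ltcR lt_min => /andP[wh wb] wz.
apply: eA => /=; rewrite er -opprB normrN normc_cabs ltcR fg ?ltW //.
by apply: le_lt_trans (hb w (ltW wb)) _; lra.
Qed.

End Cpow.

Section Trig.
Variable R : realType.
Implicit Types x : R.

Lemma sin_natpi n x : exists e : bool, sin (x + n%:R * pi) = (-1) ^+ e * sin x.
Proof.
elim: n => [|n [e IH]]; first by exists false; rewrite mul0r addr0 mul1r.
exists (~~ e); rewrite -natr1 mulrDl mul1r addrA sinDpi IH.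
by case: e {IH}; rewrite ?expr0 ?expr1 ?mulN1r ?mul1r ?opprK.
Qed.

Lemma sin_intpi (k : int) : sin (k%:~R * pi) = 0 :> R.
Proof.
have nat_case n : sin (n%:R * pi) = 0 :> R.
  by have [e] := sin_natpi n 0; rewrite add0r sin0 mulr0.
case: k => n; first exact: nat_case.
by rewrite NegzE mulrNz mulNr sinN nat_case oppr0.
Qed.

(** Subtracting the integral multiple of pi below x leaves a point of [0, pi), where the sine
    vanishes at 0 only. *)
Lemma sin_eq0_intpi x : sin x = 0 -> exists k : int, x = k%:~R * pi.
Proof.
have pi0 : 0 < pi :> R by exact: pi_gt0.
have nonneg (y : R) : 0 <= y -> sin y = 0 -> exists n : nat, y = n%:R * pi.
  move=> y0 sy; have yp : 0 <= y / pi by apply: divr_ge0 => //; exact: pi_ge0.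
  exists (Num.truncn (y / pi)).
  have := truncn_itv yp; set n := Num.truncn _ => /andP[].
  move=> h1 h2.
  have {}h1 : n%:R * pi <= y by rewrite -ler_pdivlMr ?pi_gt0.
  have {}h2 : y < n%:R * pi + pi.
    by move: h2; rewrite -natr1 ltr_pdivrMr ?pi_gt0 // mulrDl mul1r.
  have [e] := sin_natpi n (y - n%:R * pi); rewrite subrK sy => /esym/eqP.
  rewrite mulf_eq0 signr_eq0 /= => /eqP s0.
  have [->|ne] := eqVneq y (n%:R * pi); first by [].
  have : 0 < sin (y - n%:R * pi).
    apply: sin_gt0_pi; rewrite subr_gt0 lt_neqAle eq_sym ne h1 /=; lra.
  by rewrite s0 ltxx.
have [x0|x0] := leP 0 x.
  by move=> /(nonneg _ x0)[n ->]; exists n%:Z.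
move=> sx; have [||n e] := nonneg (- x); [lra | by rewrite sinN sx oppr0 |].
by exists (- n%:Z); rewrite mulrNz mulNr -pmulrn -e opprK.
Qed.

End Trig.

(** * The spherical function at every complex parameter *)

Section Values.
Variables (R : realType) (q : nat).
Hypothesis q2 : (2 <= q)%N.
Local Notation C := R[i].
Local Notation Q := (q%:R : R).
Let Q0 : 0 < Q. Proof. by rewrite ltr0n; lia. Qed.
Let Q1 : 1 < Q. Proof. by rewrite ltr1n. Qed.
Let lnQ : 0 < ln Q. Proof. by rewrite ln_gt0. Qed.
Let q0 : q%:R != 0 :> C. Proof. by rewrite pnatr_eq0; lia. Qed.
Let q1 : q%:R + 1 != 0 :> C. Proof. by rewrite natr1 pnatr_eq0. Qed.

Lemma cpow_mul_inv (z : C) : cpow Q (- z) * cpow Q (z - 1) = q%:R^-1.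
Proof.
by rewrite -cpowD // addrA addNr add0r cpowN // cpow1 // rmorph_nat.
Qed.

Lemma powR_eq1 (t : R) : powR Q t = 1 -> t = 0.
Proof.
move=> /(congr1 (@ln R)); rewrite ln_powR ln1 => /eqP.
by rewrite mulf_eq0 (gt_eqF lnQ) orbF => /eqP.
Qed.

Lemma cpow_eq1 (w : C) : cpow Q w = 1 ->
  complex.Re w = 0 /\ cos (complex.Im w * ln Q) = 1.
Proof.
move=> h; have := congr1 (@cabs R) h; rewrite cabs_cpow // cabs1 => /powR_eq1 w0.
by move: h; rewrite /cpow w0 powRr0 mul1r => -[].
Qed.

Lemma phi_expr_sph (z : C) n : cpow Q (- z) != cpow Q (z - 1) ->
  phi_expr q z n = sph q (cpow Q (- z) + cpow Q (z - 1)) n.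
Proof.
set a := cpow Q (- z); set b := cpow Q (z - 1) => ab.
have e1 : cpow Q (1 - z) = q%:R * a by rewrite cpowD // cpow1 // rmorph_nat.
have e2 : cpow Q (1 - (1 - z)) = q%:R * b.
  have -> : 1 - (1 - z) = 1 + (z - 1) by ring.
  by rewrite cpowD // cpow1 // rmorph_nat.
have e3 : cpow Q (1 - z - 1) = a by rewrite addrAC subrr add0r.
have e4 : cpow Q (- (1 - z)) = b by rewrite opprB.
have ab0 : a - b != 0 by rewrite subr_eq0.
have ba0 : b - a != 0 by rewrite subr_eq0 eq_sym.
have h := sph_closed q1 (cpow_mul_inv z) n; rewrite -/a -/b in h.
rewrite /phi_expr /fq !cpowMn // e1 e2 e3 e4 -/a -/b.
have -> : ((Q + 1)^-1)%:C = (q%:R + 1)^-1 :> C by rewrite fmorphV rmorphD rmorph_nat rmorph1.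
have d0 : (q%:R + 1) * (a - b) != 0 by rewrite mulf_neq0.
apply: (mulfI d0); rewrite h; field.
by rewrite q1 ab0 ba0.
Qed.

Lemma cont_at_sph (z : C) n :
  cont_at (fun w => sph q (cpow Q (- w) + cpow Q (w - 1)) n) z.
Proof.
have cN : cont_at (fun w => - w) z.
  move=> e e0; exists e => // w; have -> : - w - - z = - (w - z) by ring.
  by rewrite cabsN.
have cB : cont_at (fun w => w - 1) z.
  by apply: cont_atD; [exact: cont_at_id | exact: cont_at_cst].
have cs : cont_at (fun w => cpow Q (- w) + cpow Q (w - 1)) z.
  apply: cont_atD; apply: cont_at_comp => //; exact: cont_at_cpow.
elim/nat_ind2: n => [||n IH0 IH1]; first exact: cont_at_cst.
  by apply: cont_atM => //; exact: cont_at_cst.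
have -> : (fun w => sph q (cpow Q (- w) + cpow Q (w - 1)) n.+2) =
    (fun w => (cpow Q (- w) + cpow Q (w - 1)) * sph q (cpow Q (- w) + cpow Q (w - 1)) n.+1 +
      - q%:R^-1 * sph q (cpow Q (- w) + cpow Q (w - 1)) n).
  by apply/funext => w; rewrite sphSS mulNr.
by apply: cont_atD; apply: cont_atM => //; exact: cont_at_cst.
Qed.

Lemma singular_isolated (z : C) : cpow Q (- z) = cpow Q (z - 1) ->
  exists2 h : R, 0 < h & forall w, w != z -> cabs (w - z) <= h ->
    cpow Q (- w) != cpow Q (w - 1).
Proof.
have sing v : cpow Q (- v) = cpow Q (v - 1) -> cpow Q (2 * v - 1) = 1.
  move=> e; have -> : 2 * v - 1 = v + (v - 1) by ring.
  by rewrite cpowD // -e -cpowD // subrr cpow0.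
(* Singular points are those with q^(2z-1) = 1. This radius keeps the argument of the cosine within
   [0, pi], where it is injective, so no second one fits. *)
move=> /sing ez; exists (pi / (2 * ln Q)).
  by rewrite divr_gt0 ?pi_gt0 // mulr_gt0.
move=> w wz wh; apply/eqP => /sing ew; case/eqP: wz.
have H : cpow Q (2 * (w - z)) = 1.
  have -> : 2 * (w - z) = (2 * w - 1) + - (2 * z - 1) by ring.
  by rewrite cpowD // cpowN // ez ew invr1 mulr1.
suff: w - z = 0 by move=> /eqP; rewrite subr_eq0 => /eqP.
move: (cabs_Im (w - z)) wh H; move: (w - z) => t tI th.
rewrite mulr_natl mulr2n => /cpow_eq1[].
case: t tI th => x y /= tI th xx.
have -> : x = 0 by lra.
have -> : y + y = 2 * y by ring.
rewrite -cos_norm => c1.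
have yb : `|y| <= pi / (2 * ln Q) by apply: le_trans th.
have : `|2 * y * ln Q| = 0.
  apply: cos_inj; rewrite ?cos0 ?in_itv /= ?normr_ge0 ?lexx ?pi_ge0 //.
  rewrite !normrM (ger0_norm (ltW lnQ)) ger0_norm //.
  by move: yb; rewrite ler_pdivlMr ?mulr_gt0 // mulrCA mulrA.
move=> /eqP; rewrite normr_eq0 !mulf_eq0 (gt_eqF lnQ) orbF pnatr_eq0 /= => /eqP ->.
by [].
Qed.

(** The right side is a polynomial in q^(-z) + q^(z-1), hence continuous, and the singular points
    are isolated; so it also gives the limits there. *)
Lemma phidot_sph (z : C) n : phidot q z n = sph q (cpow Q (- z) + cpow Q (z - 1)) n.
Proof.
rewrite /phidot subr_eq0; case: ifPn => [ab|/negPn/eqP ab]; first exact: phi_expr_sph.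
have [h h0 hh] := singular_isolated ab.
apply: (lim_punctured (g := fun w => sph q (cpow Q (- w) + cpow Q (w - 1)) n) h0) => //; first exact: cont_at_sph.
by move=> w wz wh; apply: phi_expr_sph; exact: hh.
Qed.

(** The argument is s at an exceptional point: a^2 = 1 and ab = 1/q force b = a/q. *)
Lemma sph_sign (a : C) n : a ^+ 2 = 1 -> sph q (a + a / q%:R) n = a ^+ n.
Proof.
move=> a2; elim/nat_ind2: n => [||n IH0 IH1] //.
  by rewrite -[sph q _ 1]/(q%:R / (q%:R + 1) * (a + a / q%:R)) expr1; field; rewrite q0 q1.
rewrite sphSS IH0 IH1.
have -> : a ^+ n = a ^+ n.+2 by rewrite !exprS mulrA -expr2 a2 mul1r.
by rewrite !exprS; ring.
Qed.

Lemma sph_cheb (s : C) n :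
  sph q s n.+1 = (q%:R * cheb q s n.+2 - q%:R^-1 * cheb q s n) / (q%:R + 1).
Proof.
elim/nat_ind2: n => [||n IH0 IH1].
- rewrite -[sph q _ 1]/(q%:R / (q%:R + 1) * s) -[cheb q s 2]/(s * 1 - q%:R^-1 * 0) -[cheb _ _ 0]/0.
  by field; rewrite q0 q1.
- rewrite sphSS -[sph q _ 1]/(q%:R / (q%:R + 1) * s) -[sph _ _ 0]/1 chebSS.
  rewrite -[cheb q s 2]/(s * 1 - q%:R^-1 * 0) -[cheb q s 1]/1.
  by field; rewrite q0 q1.
rewrite sphSS IH0 IH1 !chebSS; field.
by rewrite q0 q1.
Qed.

End Values.

(** * Sums of squares *)

Section RealSums.
Variable R : realType.
Local Notation C := R[i].

Lemma expr_small (t e : R) : 0 <= t -> t < 1 -> 0 < e ->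
  exists N, forall n, (N <= n)%N -> t ^+ n <= e.
Proof.
move=> t0 t1 e0; have nt : `|t| < 1 by rewrite ger0_norm.
have /cvgrPdist_le/(_ e e0)[N _ hN] := cvg_expr nt.
exists N => n /hN; rewrite sub0r normrN ger0_norm // exprn_ge0 //.
Qed.

Lemma natmul_expr_le (t : R) n : 0 <= t -> t < 1 -> n.+1%:R * t ^+ n <= (1 - t)^-1.
Proof.
move=> t0 t1; rewrite -[X in _ <= X]mul1r ler_pdivlMr; last by lra.
apply: (@le_trans _ _ ((\sum_(i < n.+1) t ^+ i) * (1 - t))).
  rewrite ler_wpM2r ?subr_ge0 ?(ltW t1) //.
  have -> : n.+1%:R * t ^+ n = \sum_(i < n.+1) t ^+ n by rewrite sumr_const card_ord mulr_natl.
  by apply: ler_sum => i _; rewrite ler_wiXn2l ?(ltW t1) // -ltnS.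
have -> : (\sum_(i < n.+1) t ^+ i) * (1 - t) = 1 - t ^+ n.+1.
  by rewrite mulrC -opprB mulNr -subrX1 opprB.
by rewrite gerBl exprn_ge0.
Qed.

Lemma cabs_nat n : cabs (n%:R : C) = n%:R.
Proof. by rewrite -(rmorph_nat (real_complex R)) cabs_real. Qed.

Lemma sum_inv_sqr N : \sum_(i < N) (i.+1%:R^-1 : R) ^+ 2 <= 2.
Proof.
(* Strengthened by a telescoping term so that the induction closes. *)
suff: \sum_(i < N.+1) (i.+1%:R^-1 : R) ^+ 2 <= 2 - N.+1%:R^-1.
  have : (0 : R) <= N.+1%:R^-1 by rewrite invr_ge0.
  have : (0 : R) <= N.+1%:R^-1 ^+ 2 by rewrite exprn_ge0 // invr_ge0.
  rewrite big_ord_recr /=; move: (N.+1%:R^-1) (\sum_(i < N) _) => t S; lra.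
elim: N => [|N IH]; first by rewrite big_ord1 invr1 expr1n; lra.
rewrite big_ord_recr /=; apply: le_trans (lerD IH (lexx _)) _.
have N0 : (0 : R) < N.+1%:R by rewrite ltr0n.
have N1 : (0 : R) < N.+2%:R by rewrite ltr0n.
have -> : N.+1%:R^-1 = N.+2%:R^-1 + (N.+1%:R * N.+2%:R)^-1 :> R.
  rewrite -[N.+2%:R]natr1; field; rewrite gt_eqF //= gt_eqF // natr1 //.
have : (N.+2%:R^-1 : R) ^+ 2 <= (N.+1%:R * N.+2%:R)^-1.
  by rewrite exprVn lef_pV2 ?posrE ?mulr_gt0 ?exprn_gt0 // expr2 ler_wpM2r ?ler0n // ler_nat.
move: (N.+2%:R^-1) ((N.+1%:R * N.+2%:R)^-1) => t S; lra.
Qed.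

Lemma harmonic_unbounded (B : R) : exists M, B <= \sum_(i < M) i.+1%:R^-1.
Proof.
have pow k : (k%:R / 2 : R) <= \sum_(i < 2 ^ k) i.+1%:R^-1.
  elim: k => [|k IH]; first by rewrite mul0r sumr_ge0 // => i _; rewrite invr_ge0.
  rewrite expnS mul2n -addnn big_split_ord /= -natr1 mulrDl lerD //.
  apply: (@le_trans _ _ (\sum_(i < 2 ^ k) (2 ^ k.+1)%N%:R^-1)).
    rewrite sumr_const card_ord -[X in _ <= X]mulr_natl expnS natrM.
    have : ((2 ^ k)%N%:R : R) != 0 by rewrite pnatr_eq0 expn_eq0.
    move: (2 ^ k)%N%:R => t t0; have -> : t * (2 * t)^-1 = 1 / 2 by field.
    exact: lexx.
  apply: ler_sum => i _; rewrite lef_pV2 ?posrE ?ltr0n ?expn_gt0 // ler_nat expnS.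
  by have := ltn_ord i; lia.
have [B0|B0] := leP B 0; first by exists 0%N; rewrite big_ord0.
exists (2 ^ Num.bound (B * 2))%N; apply: le_trans (pow _).
by rewrite ler_pdivlMr // ltW // archi_boundP // mulr_ge0 // ltW.
Qed.

End RealSums.

(** * Decay, energy and lower bounds for [cheb] *)

Section Estimates.
Variables (R : realType) (q : nat).
Hypothesis q2 : (2 <= q)%N.
Local Notation C := R[i].
Local Notation Q := (q%:R : R).
Let Q0 : 0 < Q. Proof. by rewrite ltr0n; lia. Qed.
Let Q1 : 1 < Q. Proof. by rewrite ltr1n. Qed.
Let lnQ : 0 < ln Q. Proof. by rewrite ln_gt0. Qed.
Let q0 : q%:R != 0 :> C. Proof. by rewrite pnatr_eq0; lia. Qed.

Lemma cheb_decay (a b : C) : a * b = q%:R^-1 -> cabs a < 1 -> cabs b < 1 ->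
  forall e : R, 0 < e -> exists n0, forall n, (n0 <= n)%N -> cabs (cheb q (a + b) n) <= e.
Proof.
move=> ab a1 b1 e e0.
pose rho := Num.max (cabs a) (cabs b).
have rho0 : 0 <= rho by rewrite le_max cabs_ge0.
have rho1 : rho < 1 by rewrite gt_max a1 b1.
(* |g_n| is at most (n+1) rho^n; with rho = t^2 one factor t^n absorbs n + 1 and the other still
   tends to 0. *)
pose t := Num.sqrt rho.
have tE : t ^+ 2 = rho by rewrite sqr_sqrtr.
have t0 : 0 <= t by exact: sqrtr_ge0.
have t1 : t < 1 by rewrite -(@expr_lt1 _ 2) // tE.
have et : 0 < e * (1 - t) by rewrite mulr_gt0 // subr_gt0.
have [N hN] := expr_small t0 t1 et.
exists N.+1 => -[//|n] /(hN n) tn.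
rewrite cheb_sum //=; apply: le_trans (cabs_sum _ _ _) _.
apply: (@le_trans _ _ (\sum_(i < n.+1) rho ^+ n)).
  apply: ler_sum => i _; rewrite cabsM !cabsX.
  have -> : rho ^+ n = rho ^+ i * rho ^+ (n - i) by rewrite -exprD subnKC // -ltnS.
  by apply: ler_pM; rewrite ?exprn_ge0 ?cabs_ge0 // lerXn2r ?nnegrE ?cabs_ge0 // le_max lexx ?orbT.
rewrite sumr_const card_ord -[_ *+ _]mulr_natl -tE exprAC expr2 mulrA.
apply: le_trans (_ : (1 - t)^-1 * (e * (1 - t)) <= _); last first.
  by rewrite mulrCA mulVf ?mulr1 // gt_eqF // subr_gt0.
by apply: ler_pM; rewrite ?mulr_ge0 ?exprn_ge0 // natmul_expr_le.
Qed.

Lemma sph_decay (s : C) :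
  (forall e : R, 0 < e -> exists n0, forall n, (n0 <= n)%N -> cabs (cheb q s n) <= e) ->
  forall e : R, 0 < e -> exists n0, forall n, (n0 <= n)%N -> cabs (sph q s n) <= e.
Proof.
move=> h e e0; have [n0 hn] := h e e0; exists n0.+1 => -[//|n] n0n.
rewrite sph_cheb // cabsM cabsV natr1 cabs_nat ler_pdivrMr ?ltr0n //.
apply: le_trans (cabsB _ _) _; rewrite !cabsM cabsV !cabs_nat -natr1 mulrDr mulr1 mulrC lerD //.
  by rewrite ler_wpM2r // hn //; lia.
have Qi : Q^-1 <= 1 by rewrite invf_le1 // ltW.
rewrite -[X in _ <= X]mul1r; apply: ler_pM; rewrite ?cabs_ge0 ?invr_ge0 // hn //; lia.
Qed.

Lemma sqr_cabs_ReIm (w : C) : cabs w ^+ 2 = complex.Re w ^+ 2 + complex.Im w ^+ 2.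
Proof. by rewrite sqr_sqrtr // addr_ge0 ?sqr_ge0. Qed.

(* Lyapunov function: the quadratic form below decreases by |G(n+1)|^2 along
   the recurrence, and its initial value is A. *)
Lemma cheb_energy (s : C) (A c1 c2 : R) (p := Q^-1) :
  c1 * (1 + p) = - p * A * complex.Re s -> c2 * (1 - p) = - p * A * complex.Im s ->
  A * (1 - p ^+ 2) - A * (complex.Re s ^+ 2 + complex.Im s ^+ 2)
     - 2 * (c1 * complex.Re s - c2 * complex.Im s) = 1 ->
  forall N, \sum_(i < N) cabs (cheb q s i.+1) ^+ 2 = A
    - (A * cabs (cheb q s N.+1) ^+ 2 + A * p ^+ 2 * cabs (cheb q s N) ^+ 2
       + 2 * complex.Re ((c1 +i* c2) * cheb q s N.+1 * (cheb q s N)^*)).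
Proof.
move=> h1 h2 h3; elim=> [|N IH].
  by rewrite big_ord0 -[cheb q s 1]/1 -[cheb q s 0]/0 cabs1 cabs0 conjC0 mulr0 /=; ring.
have pC : q%:R^-1 = p%:C :> C by rewrite fmorphV rmorph_nat.
rewrite big_ord_recr /= {}IH !sqr_cabs_ReIm chebSS pC.
case: (cheb q s N.+1) => x1 x2; case: (cheb q s N) => y1 y2.
case: s h1 h2 h3 => s1 s2 /= h1 h2 h3.
have H3 : (A * (1 - p ^+ 2) - A * (s1 ^+ 2 + s2 ^+ 2) - 2 * (c1 * s1 - c2 * s2))
   * (x1 ^+ 2 + x2 ^+ 2) = x1 ^+ 2 + x2 ^+ 2 by rewrite h3 mul1r.
have H1 : c1 * (1 + p) * (x1 * y1 + x2 * y2) = - p * A * s1 * (x1 * y1 + x2 * y2) by rewrite h1.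
have H2 : c2 * (1 - p) * (x2 * y1 - x1 * y2) = - p * A * s2 * (x2 * y1 - x1 * y2) by rewrite h2.
lra.
Qed.

(* The value of sum_n |g_n|^2, from the Cauchy identity for the complete
   homogeneous polynomials g_n = h_n(a,b). *)
Definition energy (a b : C) : R :=
  (1 - Q^-1 ^+ 2) / ((1 - cabs a ^+ 2) * (1 - cabs b ^+ 2) * cabs (1 - a * b^*) ^+ 2).

Section EnergySum.
Variables a b : C.
Hypotheses (ab : a * b = q%:R^-1) (a1 : cabs a < 1) (b1 : cabs b < 1).

Let p_lt1 : Q^-1 < 1. Proof. by rewrite invf_lt1. Qed.
Let p_gt0 : 0 < Q^-1. Proof. by rewrite invr_gt0. Qed.

Lemma energy_dens_gt0 : [/\ 0 < 1 - cabs a ^+ 2, 0 < 1 - cabs b ^+ 2 & 0 < cabs (1 - a * b^*) ^+ 2].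
Proof.
have sq (t : R) : 0 <= t -> t < 1 -> 0 < 1 - t ^+ 2 by move=> t0 t1; rewrite subr_gt0 expr_lt1.
split; [exact/sq/a1/cabs_ge0 | exact/sq/b1/cabs_ge0 |].
rewrite exprn_gt0 // lt_def cabs_eq0 cabs_ge0 andbT subr_eq0; apply/eqP => e.
have := congr1 (@cabs R) e; rewrite cabs1 cabsM cabs_conj => e1.
by have := mulr_ilt1 (cabs_ge0 a) (cabs_ge0 b) a1 b1; rewrite -e1 ltxx.
Qed.

Lemma energy_gt0 : 0 < energy a b.
Proof.
have [d1 d2 d3] := energy_dens_gt0.
apply: divr_gt0; last by apply: mulr_gt0 => //; exact: mulr_gt0.
by rewrite subr_gt0 expr_lt1 // ltW.
Qed.

Lemma energy_sum_cvg : exists2 K : R, 0 <= K & forall N,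
  `|\sum_(i < N) cabs (cheb q (a + b) i.+1) ^+ 2 - energy a b| <=
    K * (cabs (cheb q (a + b) N.+1) ^+ 2 + cabs (cheb q (a + b) N) ^+ 2).
Proof.
have [d1 d2 d3] := energy_dens_gt0.
have A0 := energy_gt0; set A := energy a b in A0 *; pose p := Q^-1.
have pl : p < 1 := p_lt1; have pg : 0 < p := p_gt0.
(* Chosen to cancel the cross terms in [cheb_energy]; the remaining condition [h3] then pins down
   the value of the energy. *)
pose c1 := - p * A * complex.Re (a + b) / (1 + p).
pose c2 := - p * A * complex.Im (a + b) / (1 - p).
have h1 : c1 * (1 + p) = - p * A * complex.Re (a + b) by rewrite divfK // gt_eqF //; lra.
have h2 : c2 * (1 - p) = - p * A * complex.Im (a + b) by rewrite divfK // gt_eqF //; lra.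
have h3 : A * (1 - p ^+ 2) - A * (complex.Re (a + b) ^+ 2 + complex.Im (a + b) ^+ 2)
     - 2 * (c1 * complex.Re (a + b) - c2 * complex.Im (a + b)) = 1.
  rewrite /c1 /c2 /A /energy -/p.
  have pC : q%:R^-1 = p%:C :> C by rewrite fmorphV rmorph_nat.
  have a0 : a != 0.
    by apply/eqP => az; move: ab; rewrite az mul0r => /esym/eqP; rewrite invr_eq0 (negbTE q0).
  move: d1 d2 d3; rewrite !sqr_cabs_ReIm.
  move: ab a0; rewrite pC; case: (a) => x y; case: (b) => u v.
  rewrite eq_complex /= => e xy d1 d2 d3.
  have n0 : 0 < x ^+ 2 + y ^+ 2.
    by rewrite lt_def addr_ge0 ?sqr_ge0 // andbT paddr_eq0 ?sqr_ge0 // !sqrf_eq0.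
  have [er ei] : x * u - y * v = p /\ x * v + y * u = 0 by move: e => [-> ->].
  (* [b] is eliminated through ab = p, that is b = p a^* / |a|^2. *)
  have uE : u = p * x / (x ^+ 2 + y ^+ 2).
    by apply: (mulIf (lt0r_neq0 n0)); rewrite divfK ?lt0r_neq0 // -er; have := congr1 (fun t => t * y) ei; lra.
  have vE : v = - p * y / (x ^+ 2 + y ^+ 2).
    by apply: (mulIf (lt0r_neq0 n0)); rewrite divfK ?lt0r_neq0 // -er; have := congr1 (fun t => t * x) ei; lra.
  have d1' := lt0r_neq0 d1; have d2' := lt0r_neq0 d2; have d3' := lt0r_neq0 d3.
  move: d1' d2' d3'; rewrite uE vE => d1' d2' d3'.
  have p1 : 1 + p != 0 by apply: lt0r_neq0; lra.
  have p2 : 1 - p != 0 by apply: lt0r_neq0; lra.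
  field; set n := x ^+ 2 + y ^+ 2 in n0 d1' d2' d3' *.
  have nn : n != 0 := lt0r_neq0 n0.
  have nn2 : n ^+ 2 != 0 by rewrite expf_neq0.
  rewrite nn p2 d1' p1 andbT /=; apply/andP; split.
    by apply: contra d3' => /eqP h; apply/eqP/(mulfI nn2); rewrite mulr0 -[RHS]h; field.
  by rewrite andbT; apply: contra d2' => /eqP h; apply/eqP/(mulfI nn2); rewrite mulr0 -[RHS]h; field.
exists (A + cabs (c1 +i* c2)) => [|N]; first by rewrite addr_ge0 ?cabs_ge0 ?ltW.
rewrite (cheb_energy h1 h2 h3) addrAC subrr add0r normrN -/p.
set X := cheb _ _ N.+1; set Y := cheb _ _ N.
have hc : `|complex.Re ((c1 +i* c2) * X * Y^*)| <= cabs (c1 +i* c2) * cabs X * cabs Y.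
  by apply: le_trans (cabs_Re _) _; rewrite !cabsM cabs_conj.
apply: le_trans (ler_normD _ _) _; rewrite normrM (ger0_norm (_ : 0 <= 2)) //.
have XY0 : 0 <= A * cabs X ^+ 2 + A * p ^+ 2 * cabs Y ^+ 2.
  have A0' := ltW A0; have sq0 (w : C) : 0 <= cabs w ^+ 2 by rewrite exprn_ge0 ?cabs_ge0.
  apply: addr_ge0; first exact: mulr_ge0.
  by apply: mulr_ge0 => //; apply: mulr_ge0 => //; rewrite exprn_ge0 // ltW.
rewrite (ger0_norm XY0).
have p2 : p ^+ 2 <= 1 by rewrite expr_le1 // ltW.
have hY : A * p ^+ 2 * cabs Y ^+ 2 <= A * cabs Y ^+ 2.
  by rewrite -mulrA ler_wpM2l ?(ltW A0) // ler_piMl ?exprn_ge0 ?cabs_ge0.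
have hXY : 2 * (cabs (c1 +i* c2) * cabs X * cabs Y) <= cabs (c1 +i* c2) * (cabs X ^+ 2 + cabs Y ^+ 2).
  have -> : 2 * (cabs (c1 +i* c2) * cabs X * cabs Y) = cabs (c1 +i* c2) * (2 * (cabs X * cabs Y)) by ring.
  by rewrite ler_wpM2l ?cabs_ge0 //; have := sqr_ge0 (cabs X - cabs Y); rewrite sqrrB; lra.
lra.
Qed.

Lemma energy_sum_approx (e : R) : 0 < e -> exists N0, forall N, (N0 <= N)%N ->
  `|\sum_(i < N) cabs (cheb q (a + b) i.+1) ^+ 2 - energy a b| <= e.
Proof.
move=> e0; have [K K0 hK] := energy_sum_cvg.
have d0 : 0 < Num.min 1 (e / (2 * (1 + K))).
  by rewrite lt_min ltr01 divr_gt0 // mulr_gt0 //; lra.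
have [N0 hN] := cheb_decay ab a1 b1 d0; exists N0 => N N0N; apply: le_trans (hK N) _.
have small n : (N0 <= n)%N -> cabs (cheb q (a + b) n) ^+ 2 <= e / (2 * (1 + K)).
  move=> /hN; rewrite le_min => /andP[h1 h2]; rewrite expr2.
  by apply: le_trans h2; rewrite ler_piMl ?cabs_ge0.
have h1 := small N N0N; have h2 := small N.+1 (leqW N0N).
apply: le_trans (_ : K * (e / (1 + K)) <= _).
  have -> : e / (1 + K) = e / (2 * (1 + K)) + e / (2 * (1 + K)) by field; apply: lt0r_neq0; lra.
  by rewrite ler_wpM2l // lerD.
rewrite mulrCA ger_pMr // ler_pdivrMr; lra.
Qed.

Lemma energy_sum_le N : \sum_(i < N) cabs (cheb q (a + b) i.+1) ^+ 2 <= energy a b.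
Proof.
apply/ler_addgt0Pr => e /energy_sum_approx[N0 h].
have := h (maxn N N0) (leq_maxr _ _); rewrite ler_norml => /andP[_].
move=> h1; have {h1} : \sum_(i < maxn N N0) cabs (cheb q (a + b) i.+1) ^+ 2 <= energy a b + e by lra.
apply: le_trans.
rewrite -!(big_mkord xpredT (fun i => cabs (cheb q (a + b) i.+1) ^+ 2)).
rewrite (@big_cat_nat _ _ _ N 0 (maxn N N0)) ?leq_maxl //= lerDl.
by apply: sumr_ge0 => i _; rewrite exprn_ge0 ?cabs_ge0.
Qed.

End EnergySum.

(** As |b| = 1/(q|a|) is at most 1/q, the difference a^(n+1) - b^(n+1) has modulus at least 1 -
    1/q. *)
Lemma cheb_ge (a b : C) : a * b = q%:R^-1 -> 1 <= cabs a ->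
  exists2 k : R, 0 < k & forall n, k <= cabs (cheb q (a + b) n.+1).
Proof.
move=> ab a1.
have ba : cabs a * cabs b = Q^-1 by rewrite -cabsM ab cabsV cabs_nat.
have bp : cabs b <= Q^-1 by rewrite -ba ler_peMl ?cabs_ge0.
have pl : Q^-1 < 1 by rewrite invf_lt1.
have b1 : cabs b < 1 by apply: le_lt_trans pl.
have ab0 : 0 < cabs (a - b).
  rewrite lt_def cabs_ge0 andbT cabs_eq0 subr_eq0; apply/eqP => e.
  by move: b1; rewrite -e ltNge a1.
exists ((1 - Q^-1) / cabs (a - b)) => [|n]; first by rewrite divr_gt0 // subr_gt0.
rewrite ler_pdivrMr // mulrC -cabsM cheb_closed //.
have h1 : 1 <= cabs a ^+ n.+1 by exact: exprn_ege1.
have h2 : cabs b ^+ n.+1 <= Q^-1.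
  apply: le_trans bp; rewrite exprS ler_piMr ?cabs_ge0 // exprn_ile1 ?cabs_ge0 //; exact: ltW.
have : cabs (a ^+ n.+1) <= cabs (a ^+ n.+1 - b ^+ n.+1) + cabs (b ^+ n.+1).
  by rewrite -{1}(subrK (b ^+ n.+1) (a ^+ n.+1)) cabsD.
rewrite !cabsX; lra.
Qed.

Lemma sq_eq1_sin (w : C) : cpow Q w ^+ 2 = 1 ->
  complex.Re w = 0 /\ exists k : int, complex.Im w * ln Q = k%:~R * pi.
Proof.
rewrite expr2 -cpowD // => /cpow_eq1[] // ; case: w => x y /= xx cc.
split; first by lra.
apply: sin_eq0_intpi; apply/eqP; rewrite -sqrf_eq0.
by move: cc; rewrite mulrDl -mulr2n cos_mulr2n cos2sin2 => cc; apply/eqP; lra.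
Qed.

Lemma sin_eq0_sq (w : C) (k : int) : complex.Re w = 0 -> complex.Im w * ln Q = k%:~R * pi ->
  cpow Q w ^+ 2 = 1.
Proof.
move=> w0 wk; rewrite /cpow w0 powRr0 wk mul1r sin_intpi expr2.
have := cos2Dsin2 (k%:~R * pi : R); rewrite sin_intpi expr0n addr0 => c2.
by apply/eqP; rewrite eq_complex /= !mulr0 !mul0r subr0 addr0 -expr2 c2 !eqxx.
Qed.

End Estimates.

(** * Spherical functions as Schur multipliers *)

Section RankOneKernels.
Variables (R : realType) (X : eqType).
Local Notation C := R[i].

Lemma schur_sign_bound (sig : X -> C) (a : X -> X -> C) (M : R) :
  (forall x, cabs (sig x) = 1) -> (mxnorm a <= M%:E)%E ->
  (mxnorm (schur_mul (fun x y => sig x * sig y)%R a) <= M%:E)%E.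
Proof.
move=> sig1 aM.
have M0 : 0 <= M by rewrite -lee_fin; apply: le_trans aM; apply: mxnorm_ge0.
apply: mxnorm_le => s u v us lu lv.
apply: (@le_trans _ _ (1 * M * ((l2sq s u + l2sq s v) / 2))).
  apply: (@schur_factor_bound _ _ s unit [:: tt] (fun x _ => sig x)) => //.
    by move=> x y _ _; rewrite big_seq1.
  by move=> x _; rewrite big_seq1 sig1 expr1n.
rewrite mul1r -[X in _ <= X]mulr1 ler_wpM2l //; lra.
Qed.

(** Tests a multiplier at one diagonal entry, which gives lower bounds for [schur_norm]. *)
Definition unit_mx (x0 : X) (x y : X) : C := (x == x0)%:R * (y == x0)%:R.

Lemma mxnorm_unit (x0 : X) : mxnorm (unit_mx x0) = 1%E.
Proof.
apply/eqP; rewrite eq_le; apply/andP; split.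
  apply: mxnorm_le => s u v us lu lv.
  have -> : bform s (unit_mx x0) u v =
      (\sum_(x <- s) (x0 == x)%:R * (v x)^*) * (\sum_(y <- s) (x0 == y)%:R * u y).
    rewrite big_distrl; apply: eq_bigr => x _ /=; rewrite big_distrr; apply: eq_bigr => y _ /=.
    by rewrite /unit_mx ![_ == x0]eq_sym; ring.
  have b1 (w : X -> C) : l2sq s w <= 1 -> cabs (\sum_(x <- s) (x0 == x)%:R * w x) <= 1.
    move=> lw; have [xs|xs] := boolP (x0 \in s).
      rewrite sum_delta // -(@expr_le1 _ 2) ?cabs_ge0 //; apply: le_trans lw.
      rewrite /l2sq (bigD1_seq x0) //= lerDl; apply: sumr_ge0 => i _.
      by rewrite exprn_ge0 ?cabs_ge0.
    rewrite big_seq big1 ?cabs0 // => x; case: eqP => [<-|_ _]; last by rewrite mul0r.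
    by rewrite (negbTE xs).
  rewrite cabsM; apply: mulr_ile1; rewrite ?cabs_ge0 ?b1 //.
  have <- // : l2sq s v = l2sq s (fun x => (v x)^*) by apply: eq_bigr => x _; rewrite cabs_conj.
have := @le_mxnorm R X [:: x0] (unit_mx x0) (fun=> 1) (fun=> 1).
rewrite /l2sq /bform !big_seq1 /unit_mx !eqxx cabs1 expr1n conjC1 !mulr1 cabs1.
exact.
Qed.

End RankOneKernels.

Section SpecialPoints.
Variables (R : realType) (X : eqType) (q : nat) (adj : rel X).
Hypothesis tree : is_htree q adj.
Local Notation C := R[i].
Variable t : C.
Hypothesis t2 : t ^+ 2 = 1.

Lemma sign_walk (r x : X) (p : seq X) : path adj x p ->
  t ^+ gdist adj x r = t ^+ size p * t ^+ gdist adj (last x p) r.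
Proof.
elim: p x => [|y p IH] x /=; first by rewrite mul1r.
move=> /andP[axy pp]; rewrite exprS -mulrA -IH // -exprS.
have h1 := gdist_adj tree r axy.
have h2 : (gdist adj y r <= (gdist adj x r).+1)%N.
  by apply: (gdist_adj tree); case: tree => sym _ _ _ _; rewrite sym.
have h3 := gdist_adj_neq tree (r := r) axy.
have [->//|->] : gdist adj x r = (gdist adj y r).+1 \/ gdist adj y r = (gdist adj x r).+1 by lia.
by rewrite !exprS mulrA -expr2 t2 mul1r.
Qed.

(** Every edge changes the distance to [r] by exactly one, so d(x,y) and d(x,r) + d(y,r) have the
    same parity. *)
Lemma sign_gdist (r x y : X) :
  t ^+ gdist adj x y = t ^+ gdist adj x r * t ^+ gdist adj y r.
Proof.
have [[p [pp <- <-]] _] := gdistP tree x y.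
by rewrite (sign_walk r pp) -mulrA -expr2 exprAC t2 expr1n mulr1.
Qed.

Lemma sign_schur_bound (x0 : X) (a : X -> X -> C) (M : R) : (mxnorm a <= M%:E)%E ->
  (mxnorm (schur_mul (fun x y => t ^+ gdist adj x y)%R a) <= M%:E)%E.
Proof.
have -> : (fun x y => t ^+ gdist adj x y) =
    (fun x y => t ^+ gdist adj x x0 * t ^+ gdist adj y x0).
  by apply/funext => x; apply/funext => y; exact: sign_gdist.
apply: schur_sign_bound => x; rewrite cabsX.
have : cabs t ^+ 2 = 1 by rewrite -cabsX t2 cabs1.
by move=> /eqP; rewrite sqrp_eq1 ?cabs_ge0 // => /eqP ->; rewrite expr1n.
Qed.

Lemma sign_schur_norm (x0 : X) : schur_norm (fun x y => t ^+ gdist adj x y)%R = 1%E.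
Proof.
apply/eqP; rewrite eq_le; apply/andP; split.
  by apply: ge_ereal_sup => _ [a /= a1 <-]; exact: sign_schur_bound.
rewrite -(mxnorm_unit R x0).
apply: ereal_sup_ubound; exists (unit_mx R x0) => /=; first by rewrite mxnorm_unit.
congr mxnorm; apply/funext => x; apply/funext => y; rewrite /schur_mul /unit_mx.
have [->|_] := eqVneq x x0; last by rewrite mul0r mulr0.
have [->|_] := eqVneq y x0; last by rewrite !mulr0.
by rewrite (gdistxx tree) expr0 mul1r.
Qed.

End SpecialPoints.

Section Sphericals.
Variables (R : realType) (q : nat) (X : eqType) (adj : rel X) (x0 : X).
Hypotheses (q2 : (2 <= q)%N) (tree : is_htree q adj).
Local Notation C := R[i].
Local Notation Q := (q%:R : R).
Let Q0 : 0 < Q. Proof. by rewrite ltr0n; lia. Qed.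
Let Q1 : 1 < Q. Proof. by rewrite ltr1n. Qed.

Variable s : C.
Local Notation psi := (fun x y => sph q s (gdist adj x y)).
Local Notation G := (cheb q s).
Local Notation kap := (kappa q s).

Lemma spherical_upper (S : R) :
  (forall e : R, 0 < e -> exists n0, forall n, (n0 <= n)%N -> cabs (G n) <= e) ->
  (forall N, \sum_(i < N) cabs (G i.+1) ^+ 2 <= S) ->
  forall a (M : R), (mxnorm a <= M%:E)%E ->
  (mxnorm (schur_mul psi a) <= ((1 - Q^-1) * cabs kap * S * M)%R%:E)%E.
Proof.
move=> hG hS.
have [c [cadj cxor cmerge]] := exists_end tree q2 x0.
have [ch chP] := end_children tree cadj cxor.
move=> a M; apply: (schur_upper q2 chP (gdist_merge tree cadj cxor)
  (iter_end_inj tree cadj cxor) (exists_first_merge cmerge)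
  (first_mergeP tree cadj cxor) hG _ hS).
exact: sph_decay.
Qed.

(** The matrix is chosen before [M], so growing sums refute boundedness with a single matrix, as the
    negation of [is_schur] demands. *)
Lemma spherical_lower (xi : nat -> C) (gam : nat -> R) :
  (forall N, \sum_(i < N) cabs (xi i) ^+ 2 <= 1) ->
  (forall i, 0 <= gam i) -> (forall i, xi i * G i.+1 = (gam i)%:C) ->
  exists2 a : X -> X -> C, (mxnorm a <= 1)%E & forall (N : R) M,
    (mxnorm (schur_mul psi a) <= N%:E)%E ->
    (1 - Q^-1) * cabs kap * (\sum_(i < M) gam i) ^+ 2 <= N.
Proof.
move=> xi1 gam0 gamE.
have [c [cadj cxor cmerge]] := exists_end tree q2 x0.
have [ch chP] := end_children tree cadj cxor.
have cinj := iter_end_inj tree cadj cxor.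
have [dep [dep_c dep_desc]] := exists_depth x0 cinj cmerge.
pose r := Num.sqrt Q^-1.
have r0 : 0 <= r by exact: sqrtr_ge0.
have r2 : r ^+ 2 = Q^-1 by rewrite sqr_sqrtr // invr_ge0.
exists (test_mx q c dep r xi); first exact: (test_mx_norm q2 chP).
move=> N M.
exact: (schur_lower q2 chP (gdist_merge tree cadj cxor) cinj dep_desc).
Qed.

Lemma spherical_lower_energy M (N : R) : (schur_norm psi <= N%:E)%E ->
  (1 - Q^-1) * cabs kap * (\sum_(i < M) cabs (G i.+1) ^+ 2) <= N.
Proof.
move=> hN; case: M => [|M].
  (* The empty family cannot be normalised; here only N >= 0 is claimed. *)
  rewrite big_ord0 mulr0 -lee_fin; apply: le_trans hN.
  apply: le_trans (mxnorm_ge0 (schur_mul psi (unit_mx R x0))) _.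
  by apply: ereal_sup_ubound; exists (unit_mx R x0) => //=; rewrite mxnorm_unit.
pose S := \sum_(i < M.+1) cabs (G i.+1) ^+ 2.
have sq0 i : 0 <= cabs (G i.+1) ^+ 2 by rewrite exprn_ge0 ?cabs_ge0.
have S0 : 0 < S.
  rewrite /S big_ord_recl -[G 1]/1 cabs1 expr1n.
  by apply: lt_le_trans ltr01 _; rewrite lerDl sumr_ge0.
have sS : Num.sqrt S ^+ 2 = S by rewrite sqr_sqrtr ?ltW.
have sS0 : 0 < Num.sqrt S by rewrite sqrtr_gt0.
(* The equality case of Cauchy-Schwarz, cut off at [M.+1]. *)
pose xi i : C := if (i < M.+1)%N then (G i.+1)^* / (Num.sqrt S)%:C else 0.
pose gam i := if (i < M.+1)%N then cabs (G i.+1) ^+ 2 / Num.sqrt S else 0.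
have [||| a a1 ha] := @spherical_lower xi gam.
- move=> N'.
  have e i : cabs (xi i) ^+ 2 = if (i < M.+1)%N then cabs (G i.+1) ^+ 2 / S else 0.
    rewrite /xi; case: ifP => _; last by rewrite cabs0 expr0n.
    by rewrite cabsM cabsV cabs_conj cabs_real ?(ltW sS0) // exprMn exprVn sS.
  apply: (@le_trans _ _ (\sum_(i < M.+1) cabs (G i.+1) ^+ 2 / S)); last first.
    by rewrite -mulr_suml divff // gt_eqF.
  under eq_bigr do rewrite e.
  rewrite -(big_mkord xpredT (fun i => if (i < M.+1)%N then cabs (G i.+1) ^+ 2 / S else 0)).
  rewrite -big_mkcond -(big_mkord xpredT (fun i => cabs (G i.+1) ^+ 2 / S)).
  have nn i : 0 <= cabs (G i.+1) ^+ 2 / S by rewrite divr_ge0 // ltW.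
  have [h|h] := leqP N' M.+1.
    rewrite [X in _ <= X](big_cat_nat (n := N')) //= -[X in X <= _]addr0 lerD ?sumr_ge0 //.
    rewrite big_nat_cond [X in _ <= X]big_nat_cond le_eqVlt; apply/orP; left; apply/eqP.
    by apply: eq_bigl => i /=; lia.
  rewrite (big_cat_nat (n := M.+1)) //=; last by lia.
  rewrite [X in _ + X]big_nat_cond [X in _ + X]big1 ?addr0; last by move=> i; lia.
  by rewrite big_mkcond; apply: ler_sum => i _; case: ifP.
- by move=> i; rewrite /gam; case: ifP => // _; rewrite divr_ge0 // ltW.
- move=> i; rewrite /xi /gam; case: ifP => _; last by rewrite mul0r.
  by rewrite [RHS]rmorphM /= sqr_cabs fmorphV /=; ring.
have := ha N M.+1; have -> : \sum_(i < M.+1) gam i = Num.sqrt S.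
  under eq_bigr do rewrite /gam ltn_ord.
  by rewrite -mulr_suml -/S -{1}sS expr2 mulfK // gt_eqF.
rewrite sS; apply; apply: le_trans hN; apply: ereal_sup_ubound.
by exists a.
Qed.

Lemma spherical_unbounded (k : R) : 0 < k -> (forall n, k <= cabs (G n.+1)) ->
  kap != 0 -> ~ is_schur psi.
Proof.
move=> k0 hk kap0 sch.
(* The phase makes [xi i * G i.+1] nonnegative. The factor 1/2 suffices because the inverse squares
   sum to at most 2. *)
pose xi i : C := (G i.+1)^* / (cabs (G i.+1))%:C * (i.+1%:R^-1 / 2)%:C.
pose gam i : R := cabs (G i.+1) * (i.+1%:R^-1 / 2).
have G0 i : 0 < cabs (G i.+1) by exact: lt_le_trans (hk i).
have i0 i : 0 <= i.+1%:R^-1 / 2 :> R by rewrite divr_ge0 // invr_ge0.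
have [||| a a1 ha] := @spherical_lower xi gam.
- move=> N; have e i : cabs (xi i) ^+ 2 = i.+1%:R^-1 ^+ 2 / 4.
    rewrite /xi cabsM cabsM cabsV cabs_conj !cabs_real ?cabs_ge0 //.
    rewrite divff ?gt_eqF // mul1r exprMn exprVn; congr (_ * _).
    by rewrite exprVn -natrX.
  under eq_bigr do rewrite e.
  by rewrite -mulr_suml; have := sum_inv_sqr R N; lra.
- by move=> i; rewrite mulr_ge0 ?cabs_ge0.
- move=> i; rewrite /xi /gam [RHS]rmorphM /=.
  have cn : (cabs (G i.+1))%:C != 0 by rewrite -(rmorph0 (real_complex R)) (inj_eq (@complexI R)) gt_eqF.
  have h : G i.+1 * (G i.+1)^* = (cabs (G i.+1))%:C * (cabs (G i.+1))%:C.
    by rewrite -sqr_cabs rmorphXn /= expr2.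
  by rewrite mulrC !mulrA h mulfK.
have fin : (mxnorm (schur_mul psi a) < +oo)%E.
  by apply: sch; apply: le_lt_trans a1 _; exact: ltry.
have fE : (fine (mxnorm (schur_mul psi a)))%:E = mxnorm (schur_mul psi a).
  by rewrite fineK // ge0_fin_numE // mxnorm_ge0.
set N := fine _ in fE.
have {}ha M : (1 - Q^-1) * cabs kap * (\sum_(i < M) gam i) ^+ 2 <= N by apply: ha; rewrite fE.
have pl : 0 < 1 - Q^-1 by rewrite subr_gt0 invf_lt1.
have D0 : 0 < (1 - Q^-1) * cabs kap.
  by rewrite mulr_gt0 // lt_def cabs_eq0 kap0 cabs_ge0.
set D := (1 - Q^-1) * cabs kap in ha D0.
have N0 : 0 <= N by rewrite -lee_fin fE mxnorm_ge0.
(* The threshold makes the sum of [gam] at least N/D + 1 >= 1; its square is then no smaller, and D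
   times it is at least N + D > N. *)
have [M hM] := harmonic_unbounded ((N / D + 1) * 2 / k).
have hg : N / D + 1 <= \sum_(i < M) gam i.
  apply: (@le_trans _ _ (\sum_(i < M) (k / 2) * i.+1%:R^-1)).
    rewrite -mulr_sumr; have := ler_wpM2l (ltW k0) hM.
    rewrite [k * (_ / k)]mulrC divfK ?gt_eqF // mulrAC; lra.
  apply: ler_sum => i _; rewrite /gam.
  have -> : k / 2 * i.+1%:R^-1 = k * (i.+1%:R^-1 / 2) by ring.
  by rewrite ler_wpM2r.
have ND : 0 <= N / D by rewrite divr_ge0 // ltW.
have T1 : 1 <= \sum_(i < M) gam i by apply: le_trans (hg); rewrite lerDr.
have : D * (N / D + 1) <= D * (\sum_(i < M) gam i) ^+ 2.
  rewrite ler_wpM2l ?(ltW D0) //; apply: le_trans hg _.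
  by rewrite expr2 ler_peMl // (le_trans ler01 T1).
have -> : D * (N / D + 1) = N + D by field; rewrite gt_eqF.
have := ha M; lra.
Qed.

End Sphericals.

Section NormFormula.
Variables (R : realType) (q : nat).
Hypothesis q2 : (2 <= q)%N.
Local Notation C := R[i].
Local Notation Q := (q%:R : R).
Let Q0 : 0 < Q. Proof. by rewrite ltr0n; lia. Qed.
Let Q1 : 1 < Q. Proof. by rewrite ltr1n. Qed.
Let lnQ : 0 < ln Q. Proof. by rewrite ln_gt0. Qed.
Let q1 : q%:R + 1 != 0 :> C. Proof. by rewrite natr1 pnatr_eq0. Qed.
Variable z : C.
Local Notation a := (cpow Q (- z)).
Local Notation b := (cpow Q (z - 1)).

Lemma powR_lt1 (t : R) : (powR Q t < 1) = (t < 0).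
Proof.
rewrite /powR (gt_eqF Q0) -[X in _ < X]expR0 ltr_expR.
by rewrite pmulr_llt0.
Qed.

Lemma ReB1 : complex.Re (z - 1) = complex.Re z - 1.
Proof. by case: z. Qed.

Lemma ReN : complex.Re (- z) = - complex.Re z.
Proof. by case: z. Qed.

Lemma cabs_a_lt1 : (cabs a < 1) = (0 < complex.Re z).
Proof. by rewrite cabs_cpow // powR_lt1 ReN oppr_lt0. Qed.

Lemma cabs_b_lt1 : (cabs b < 1) = (complex.Re z < 1).
Proof. by rewrite cabs_cpow // powR_lt1 ReB1 subr_lt0. Qed.

Lemma special_sq1 : (exists k : int, z = 0 +i* (k%:~R * pi / ln Q)) <-> a ^+ 2 = 1.
Proof.
split=> [[k ->]|/(sq_eq1_sin q2)[]].
  apply: (sin_eq0_sq (k := - k)) => //=; first by rewrite oppr0.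
  by rewrite mulrNz !mulNr divfK // gt_eqF.
rewrite ReN => /eqP; rewrite oppr_eq0; case: z => x y /= /eqP -> [k ky].
exists (- k); congr (_ +i* _); apply: (mulIf (lt0r_neq0 lnQ)).
by rewrite divfK ?gt_eqF // mulrNz mulNr -ky mulNr opprK.
Qed.

Lemma special_sq2 : (exists k : int, z = 1 -i* (k%:~R * pi / ln Q)) <-> b ^+ 2 = 1.
Proof.
split=> [[k ->]|/(sq_eq1_sin q2)[]].
  apply: (sin_eq0_sq (k := - k)) => //=; first by rewrite subrr.
  by rewrite subr0 mulrNz !mulNr divfK // gt_eqF.
rewrite ReB1 => /eqP; rewrite subr_eq0; case: z => x y /= /eqP -> [k]; rewrite subr0 => ky.
exists (- k); congr (_ +i* _); apply: (mulIf (lt0r_neq0 lnQ)).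
by rewrite mulNr divfK ?gt_eqF // mulrNz mulNr -ky opprK.
Qed.

(** The constant comes from (1-1/q) (q/(q+1)) (1-1/q^2) = (1-1/q)^2, and a b^* = q^(-1-2i Im z) is
    the conjugate of the power in the last factor. *)
Lemma norm_formula : (0 < complex.Re z < 1) ->
  (1 - Q^-1) * cabs (kappa q (a + b)) * energy q a b =
   ((1 - Q^-1) ^+ 2 * cabs (1 - cpow Q (- (2 * z))) * cabs (1 - cpow Q (2 * z - 2)))
   / ((1 - powR Q (- (2 * complex.Re z))) * (1 - powR Q (2 * complex.Re z - 2))
      * cabs (1 - cpow Q ((- 1) +i* (2 * complex.Im z))) ^+ 2).
Proof.
move=> /andP[z0 z1].
have a1 : cabs a < 1 by rewrite cabs_a_lt1.
have b1 : cabs b < 1 by rewrite cabs_b_lt1.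
have ab := cpow_mul_inv q2 z.
have [d1 d2 d3] := energy_dens_gt0 a1 b1.
have e1 : cpow Q (- (2 * z)) = a ^+ 2.
  by rewrite expr2 -cpowD //; congr (cpow _ _); ring.
have e2 : cpow Q (2 * z - 2) = b ^+ 2.
  by rewrite expr2 -cpowD //; congr (cpow _ _); ring.
have e3 : powR Q (- (2 * complex.Re z)) = cabs a ^+ 2.
  rewrite cabs_cpow // ReN expr2 -powRD ?(gt_eqF Q0) ?implybT //; congr (powR _ _); ring.
have e4 : powR Q (2 * complex.Re z - 2) = cabs b ^+ 2.
  rewrite cabs_cpow // ReB1 expr2 -powRD ?(gt_eqF Q0) ?implybT //; congr (powR _ _); ring.
have conj_cpow (w : C) : (cpow Q w)^* = cpow Q (w^*).
  case: w => x y; rewrite /cpow conj_mul conj_real /= mulNr cosN sinN.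
  by congr (_ * _).
have e5 : cabs (1 - cpow Q ((- 1) +i* (2 * complex.Im z))) = cabs (1 - a * b^*).
  rewrite -cabs_conj rmorphB rmorph1 /= conj_cpow; congr (cabs (1 - _)).
  rewrite conj_cpow -cpowD //; congr (cpow _ _).
  by case: z => x y; apply/eqP; rewrite eq_complex /=; apply/andP; split; apply/eqP; ring.
rewrite e1 e2 e3 e4 e5 kappa_closed // /energy.
move: d1 d2 d3; set A := 1 - cabs a ^+ 2; set B := 1 - cabs b ^+ 2; set D := cabs (1 - _) ^+ 2.
move: (1 - a ^+ 2) (1 - b ^+ 2) => u v d1 d2 d3.
rewrite !cabsM cabsV natr1 !cabs_nat -natr1; field.
by rewrite !lt0r_neq0 //; lra.
Qed.

End NormFormula.

Theorem theorem2p2 (R : realType) (q : nat) (X : eqType) (adj : rel X) (x0 : X) :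
  (2 <= q)%N -> is_htree q adj ->
  forall z : R[i],
  let Q : R := q%:R in
  let special := exists k : int,
      z = 0 +i* (k%:~R * pi / ln Q) \/ z = 1 -i* (k%:~R * pi / ln Q) in
  [/\ is_schur (phitilde q adj z) <->
        ((0 < complex.Re z < 1) \/ special),
      (0 < complex.Re z < 1) ->
        schur_norm (phitilde q adj z) =
          (((1 - Q^-1) ^+ 2 * cabs (1 - cpow Q (- (2 * z)))
                            * cabs (1 - cpow Q (2 * z - 2)))
           / ((1 - powR Q (- (2 * complex.Re z)))
              * (1 - powR Q (2 * complex.Re z - 2))
              * cabs (1 - cpow Q ((- 1) +i* (2 * complex.Im z))) ^+ 2))%:E
    & special -> schur_norm (phitilde q adj z) = 1%E].
Proof.
move=> q2 tree z Q special.
have Q1 : 1 < Q by rewrite ltr1n.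
have Q0 : 0 < Q by lra.
set a := cpow Q (- z); set b := cpow Q (z - 1).
have ab : a * b = q%:R^-1 by exact: cpow_mul_inv.
have ba : b * a = q%:R^-1 by rewrite mulrC.
have -> : phitilde q adj z = fun x y => sph q (a + b) (gdist adj x y).
  by apply/funext => x; apply/funext => y; exact: phidot_sph.
(* A bound linear in the norm of the matrix turns finiteness into finiteness. *)
have finite (psi : X -> X -> R[i]) (c : R) :
    (forall m (M : R), (mxnorm m <= M%:E)%E -> (mxnorm (schur_mul psi m) <= (c * M)%R%:E)%E) ->
    is_schur psi.
  move=> h m mfin; have mE : (fine (mxnorm m))%:E = mxnorm m.
    by rewrite fineK // ge0_fin_numE // mxnorm_ge0.
  by apply: le_lt_trans (h m (fine (mxnorm m)) _) (ltry _); rewrite mE.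
have specialP : special -> exists2 t : R[i], t ^+ 2 = 1 &
    (fun x y => sph q (a + b) (gdist adj x y)) = (fun x y => t ^+ gdist adj x y).
  have inv_eq (t w : R[i]) : t ^+ 2 = 1 -> t * w = q%:R^-1 -> w = t / q%:R.
    by move=> t2 <-; rewrite mulrA -expr2 t2 mul1r.
  move=> [k [zk|zk]].
    have a2 : a ^+ 2 = 1 by apply/special_sq1 => //; exists k.
    exists a => //; apply/funext => x; apply/funext => y.
    by rewrite (inv_eq a b) // sph_sign.
  have b2 : b ^+ 2 = 1 by apply/special_sq2 => //; exists k.
  exists b => //; apply/funext => x; apply/funext => y.
  by rewrite addrC (inv_eq b a) // sph_sign.
have strip : 0 < complex.Re z < 1 -> forall m (M : R), (mxnorm m <= M%:E)%E ->
    (mxnorm (schur_mul (fun x y => sph q (a + b) (gdist adj x y)) m)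
     <= ((1 - Q^-1) * cabs (kappa q (a + b)) * energy q a b * M)%R%:E)%E.
  move=> /andP[z0 z1]; have a1 : cabs a < 1 by rewrite cabs_a_lt1.
  have b1 : cabs b < 1 by rewrite cabs_b_lt1.
  apply: spherical_upper => //; first exact: cheb_decay.
  exact: energy_sum_le.
split.
- split=> [sch|[hz|/specialP[t t2 ->]]]; last 2 first.
  + exact: finite (strip hz).
  + by apply: (finite _ 1) => m M mM; rewrite mul1r; exact: (sign_schur_bound tree t2 x0).
  have [//|nstrip] := boolP (0 < complex.Re z < 1); first by left.
  right; apply: contrapT => nsp.
  (* The special points are exactly the zeros of the two factors of [kappa]. *)
  have na2 : 1 - a ^+ 2 != 0.
    rewrite subr_eq0 eq_sym; apply/eqP => /(special_sq1 q2)[k zk].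
    by apply: nsp; exists k; left.
  have nb2 : 1 - b ^+ 2 != 0.
    rewrite subr_eq0 eq_sym; apply/eqP => /(special_sq2 q2)[k zk].
    by apply: nsp; exists k; right.
  have kap0 : kappa q (a + b) != 0.
    rewrite kappa_closed // !mulf_neq0 // ?invr_neq0 ?natr1 ?pnatr_eq0 //; lia.
  have [k k0 hk] : exists2 k : R, 0 < k & forall n, k <= cabs (cheb q (a + b) n.+1).
    (* Outside the strip |a| or |b| is at least 1, and [cheb] depends on a + b only, so the two
       cases are symmetric. *)
    move: nstrip; rewrite negb_and -(cabs_a_lt1 q2) -(cabs_b_lt1 q2) -!leNgt => /orP[h|h].
      exact: cheb_ge.
    by rewrite addrC; exact: cheb_ge.
  exact: (spherical_unbounded x0 q2 tree k0 hk kap0 sch).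
- move=> hz; rewrite -norm_formula // -/a -/b -/Q.
  have /andP[z0 z1] := hz; have a1 : cabs a < 1 by rewrite cabs_a_lt1.
  have b1 : cabs b < 1 by rewrite cabs_b_lt1.
  set N := (X in X%:E); set psi := fun _ _ => _.
  have up : (schur_norm psi <= N%:E)%E.
    by apply: ge_ereal_sup => _ [m /= m1 <-]; have := strip hz m 1 m1; rewrite mulr1.
  have ge0 : (0 <= schur_norm psi)%E.
    apply: le_trans (mxnorm_ge0 (schur_mul psi (unit_mx R x0))) _.
    by apply: ereal_sup_ubound; exists (unit_mx R x0) => //=; rewrite mxnorm_unit.
  (* Finite by the upper bound, so the norm itself serves as the real bound in
     [spherical_lower_energy]. *)
  have nE : (fine (schur_norm psi))%:E = schur_norm psi.
    by rewrite fineK // ge0_fin_numE //; apply: le_lt_trans up (ltry _).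
  apply/eqP; rewrite eq_le up /= -nE lee_fin.
  set D := (1 - Q^-1) * cabs (kappa q (a + b)).
  have D0 : 0 <= D by rewrite mulr_ge0 ?cabs_ge0 // subr_ge0 invf_le1 // ltW.
  apply/ler_addgt0Pr => e e0.
  have e1 : 0 < e / (1 + D) by rewrite divr_gt0 //; lra.
  have [M hM] := energy_sum_approx q2 ab a1 b1 e1.
  have := hM M (leqnn M); rewrite ler_norml => /andP[h _].
  have low := @spherical_lower_energy R q X adj x0 q2 tree (a + b) M (fine (schur_norm psi)).
  rewrite nE in low; have {}low := low (lexx _); rewrite -/Q -/D in low.
  have : D * (energy q a b - e / (1 + D)) <= D * (\sum_(i < M) cabs (cheb q (a + b) i.+1) ^+ 2).
    by rewrite ler_wpM2l //; lra.
  have : D * (e / (1 + D)) <= e.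
    by rewrite mulrCA ger_pMr // ler_pdivrMr; lra.
  rewrite /N -/D mulrBr; lra.
- by move=> /specialP[t t2 ->]; exact: (sign_schur_norm tree t2 x0).
Qed.
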